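(* Let $C=(c_{ij})$ be the matrix of $d$-Dobrushin interdependence coefficients of $\mu$ and assume $$r_1:=\|C\|_1=\max_{1\le j\le N}\sum_{i=1}^N c_{ij}<\tfrac12,$$ and that for some constant $C_1>0$, $\mu_i(\cdot|x)\in T_1(C_1)$ on $(E,d)$ for all $i=1,\dots,N$ and all $x\in E^N$. Let $(Z_k)_{k\ge0}$ be the Gibbs sampler, with transition kernel $P$, started at $Z_0=x$ under $\mathbb{P}_x$. Then for any $\alpha>0$, any (Borel measurable) Lipschitzian function $f$ on $E^N$ with $\|f\|_{\mathrm{Lip}(d_{L^1})}\le\alpha$, and any $x\in E^N$: (a) for all $t>0$, $n\ge1$, $$\mathbb{P}_x\Bigl(\frac1n\sum_{k=1}^n f(Z_k)-\frac1n\sum_{k=1}^nP^kf(x)\ge t\Bigr)\le\exp\Bigl\{-\frac{t^2(1-2r_1)^2n}{2C_1\alpha^2N}\Bigr\};$$ (b) if furthermore $r:=\|C\|_\infty=\max_{1\le i\le N}\sum_{j=1}^Nc_{ij}<1$, then for all $t>0$, $n\ge1$, $$\mathbb{P}_x\Bigl(\frac1n\sum_{k=1}^n f(Z_k)-\mu(f)\ge\frac Mn+t\Bigr)\le\exp\Bigl\{-\frac{t^2(1-2r_1)^2n}{2C_1\alpha^2N}\Bigr\},$$ where $$M=\frac{r}{1-r}\,\max_{1\le i\le N}\int_{E^N}d(x^i,y^i)\,\mathrm{d}\mu(y)\cdot\sum_{i=1}^N\delta_i(f).$$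
   Context: Setting. $E$ is a Polish space with Borel $\sigma$-field $\mathscr{B}$; $d$ is a metric on $E$ such that $(x,y)\mapsto d(x,y)$ is lower semicontinuous on $E^2$ ($d$ need not generate the topology of $E$). $N\ge1$ is an integer; points of $E^N$ are written $x=(x^1,\dots,x^N)$, and $d_{L^1}(x,y):=\sum_{i=1}^N d(x^i,y^i)$ on $E^N$. $\mu$ is a Gibbs probability measure on $E^N$: $\mu(\mathrm{d}x)=\frac1Z e^{-V(x^1,\dots,x^N)}\pi(\mathrm{d}x^1)\cdots\pi(\mathrm{d}x^N)$, with $\pi$ a $\sigma$-finite measure on $E$, $V:E^N\to\mathbb{R}$ measurable and $Z=\int_{E^N} e^{-V}\,\mathrm{d}\pi^{\otimes N}\in(0,\infty)$. For $x\in E^N$, $1\le i\le N$, $\mu_i(\cdot|x)$ is the given (fixed version of the) regular conditional distribution under $\mu$ of $x^i$ knowing $(x^j)_{j\ne i}$ (a probability kernel on $E$ depending on $x$ only through $(x^j)_{j\neq i}$), i.e. $\mu_i(\mathrm{d}x^i|x)=\frac{e^{-V(x)}\pi(\mathrm{d}x^i)}{\int_E e^{-V(x)}\pi(\mathrm{d}x^i)}$. Wasserstein distance. For probability measures $\nu_1,\nu_2$ on a space with metric $\rho$, $W_{1,\rho}(\nu_1,\nu_2):=\inf_\pi\iint\rho(x,y)\,\pi(\mathrm{d}x,\mathrm{d}y)\in[0,\infty]$, the infimum being over all couplings $\pi$ of $\nu_1,\nu_2$. $\mathcal{M}_1^d(E)$ is the set of probability measures $\nu$ on $E$ with $\int_E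 d(x_0,x)\,\nu(\mathrm{d}x)<\infty$ for some fixed $x_0\in E$. Standing assumptions: $\int_{E^N} d(y^i,x_0^i)\,\mathrm{d}\mu(y)<\infty$ for all $i$ (with some fixed $x_0\in E^N$); $\mu_i(\cdot|x)\in\mathcal{M}_1^d(E)$ for all $i$ and all $x\in E^N$; and $x\mapsto\mu_i(\cdot|x)$ is Lipschitzian from $(E^N,d_{L^1})$ to $(\mathcal{M}_1^d(E),W_{1,d})$. Dobrushin coefficients. $c_{ij}:=\sup\frac{W_{1,d}(\mu_i(\cdot|x),\mu_i(\cdot|y))}{d(x^j,y^j)}$, $1\le i,j\le N$, the supremum over $x,y\in E^N$ with $x^k=y^k$ for all $k\ne j$ and $x^j\neq y^j$ (so $c_{ii}=0$); $C:=(c_{ij})$. Transport inequality. For a probability measure $\beta$ on a space with metric $\rho$ and a constant $c>0$, $\beta\in T_1(c)$ means $W_{1,\rho}(\beta,\nu)\le\sqrt{2c\,H(\nu|\beta)}$ for all probability measures $\nu$ on that space, where $H(\nu|\beta)=\int\log\frac{\mathrm{d}\nu}{\mathrm{d}\beta}\,\mathrm{d}\nu$ if $\nu\ll\beta$ and $+\infty$ otherwise. Gibbs sampler. $\bar\mu_i(x,\mathrm{d}y)=\bigl(\prod_{j\ne i}\delta_{x^j}(\mathrm{d}y^j)\bigr)\otimes\mu_i(\mathrm{d}y^i|x)$ is the kernel on $E^N$ resampling coordinate $i$, and $P:=\bar\mu_1\bar\mu_2\cdots\bar\mu_N$, where $(K_1K_2)(x,A)=\int K_1(x,\mathrm{d}y)K_2(y,A)$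 (coordinate 1 is updated first). $(Z_k)_{k\ge0}$ is the time-homogeneous Markov chain on $E^N$ with transition kernel $P$, and $P^kf(x)=\int f(y)P^k(x,\mathrm{d}y)$. $\mu(f)=\int f\,\mathrm{d}\mu$. For $f:E^N\to\mathbb{R}$, $\delta_i(f):=\sup\frac{|f(x)-f(y)|}{d(x^i,y^i)}$ over $x,y$ with $x^j=y^j$ for all $j\ne i$ and $x^i\ne y^i$, and $\|f\|_{\mathrm{Lip}(d_{L^1})}:=\sup_{x\ne y}\frac{|f(x)-f(y)|}{d_{L^1}(x,y)}$. *)

(* Defs.v *)
From HB Require Import structures.
From mathcomp Require Import all_boot all_order all_algebra.
From mathcomp Require Import all_classical all_reals all_analysis.
From mathcomp Require Import measurable_realfun.
Set Implicit Arguments.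
Unset Strict Implicit.
Unset Printing Implicit Defensive.
Import Order.TTheory GRing.Theory Num.Theory.
Import numFieldNormedType.Exports.
Local Open Scope classical_set_scope.
Local Open Scope ring_scope.

Section metric.
Context {R : realType}.

Definition is_metric (T : Type) (d : T -> T -> R) : Prop :=
  [/\ forall x y, 0 <= d x y,
      forall x y, d x y = 0 <-> x = y,
      forall x y, d x y = d y x &
      forall x y z, d x z <= d x y + d y z].

Definition metrizes (T : topologicalType) (d : T -> T -> R) : Prop :=
  forall x (A : set T), nbhs x A <->
    exists2 e : R, 0 < e & [set y | d x y < e] `<=` A.

Definition metric_complete (T : Type) (d : T -> T -> R) : Prop :=
  forall u : nat -> T,
    (forall e : R, 0 < e ->
      exists n0, forall m n, (n0 <= m)%N -> (n0 <= n)%N -> d (u m) (u n) < e) ->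
    exists l, d (u n) l @[n --> \oo] --> 0.

Definition dL1 (T : Type) (N : nat) (d : T -> T -> R) (x y : N.-tuple T) : R :=
  \sum_(i < N) d (tnth x i) (tnth y i).

End metric.

Definition polish (R : realType) (T : topologicalType) : Prop :=
  (exists2 D : set T, countable D & dense D) /\
  exists rho : T -> T -> R,
    [/\ is_metric rho, metrizes rho & metric_complete rho].

Notation borel E := (g_sigma_algebraType (@open E)).

(* Supremum in [0, +oo]: the adjoined 0 makes the supremum of the empty
   family 0 (ereal_sup set0 is -oo) and is harmless for nonnegative families. *)
Definition esup0 {R : realType} (A : set (\bar R)) : \bar R :=
  ereal_sup (A `|` [set 0%E]).

Definition agree_off (T : Type) (N : nat) (i : 'I_N) (x y : N.-tuple T) : Prop :=
  forall j, j != i -> tnth x j = tnth y j.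

Definition set_coord (T : Type) (N : nat) (i : 'I_N) (x : N.-tuple T) (u : T) :
    N.-tuple T :=
  [tuple (if j == i then u else tnth x j) | j < N].

Section function_norms.
Context {R : realType}.
Local Open Scope ereal_scope.

Definition coord_osc (T : Type) (N : nat) (d : T -> T -> R)
    (f : N.-tuple T -> R) (i : 'I_N) : \bar R :=
  esup0 [set r | exists x y, [/\ agree_off i x y, tnth x i <> tnth y i &
    r = (`|f x - f y| / d (tnth x i) (tnth y i))%R%:E]].

Definition lip_norm (T : Type) (rho : T -> T -> R) (f : T -> R) : \bar R :=
  esup0 [set r | exists x y, x <> y /\ r = (`|f x - f y| / rho x y)%R%:E].

End function_norms.

Section transport.
Local Open Scope ereal_scope.
Context {R : realType} {d} {T : measurableType d}.

Definition coupling (nu1 nu2 : {measure set T -> \bar R})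
    (g : probability (T * T)%type R) : Prop :=
  forall A, measurable A ->
    g (fst @^-1` A) = nu1 A /\ g (snd @^-1` A) = nu2 A.

Definition W1 (rho : T -> T -> R) (nu1 nu2 : {measure set T -> \bar R}) :
    \bar R :=
  ereal_inf [set \int[g]_z (rho z.1 z.2)%:E | g in coupling nu1 nu2].

Definition finite_moment (rho : T -> T -> R) (nu : {measure set T -> \bar R}) :=
  exists x0, \int[nu]_x (rho x0 x)%:E < +oo.

(* lne is -oo where the density vanishes, which is a nu-null set. *)
Definition relative_entropy (nu beta : probability T R) : \bar R :=
  if `[< nu `<< beta >] then
    \int[nu]_x lne (Radon_Nikodym (charge_of_finite_measure nu) beta x)
  else +oo.

Definition T1_ineq (rho : T -> T -> R) (c : R) (beta : probability T R) : Prop :=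
  forall nu : probability T R,
    W1 rho beta nu <= sqrte ((2 * c)%:E * relative_entropy nu beta).

End transport.

Section kernel_probability.
Context {R : realType} {d1 d2} {X : measurableType d1} {Y : measurableType d2}.

Definition kernel_at (k : R.-pker X ~> Y) (x : X) : set Y -> \bar R := k x.

Variables (k : R.-pker X ~> Y) (x : X).

HB.instance Definition _ := Measure.on (kernel_at k x).

Let kernel_at_setT : kernel_at k x setT = 1%E.
Proof. exact: prob_kernel. Qed.

HB.instance Definition _ :=
  Measure_isProbability.Build _ _ _ (kernel_at k x) kernel_at_setT.

End kernel_probability.

Section kernel_product.
Context {R : realType} {d1 d2 d3} {X : measurableType d1}
  {Y : measurableType d2} {Z : measurableType d3}.
Variables (k1 : R.-pker X ~> Y) (k2 : R.-pker Y ~> Z).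

Definition kmul : X -> {measure set Z -> \bar R} := mkcomp_noparam k1 k2.

HB.instance Definition _ := Kernel.on kmul.

Let kmul_setT x : kmul x setT = 1%E.
Proof.
rewrite /kmul /= /kcomp_noparam.
under eq_integral do rewrite prob_kernel.
by rewrite integral_cst// mul1e prob_kernel.
Qed.

HB.instance Definition _ :=
  Kernel_isProbability.Build _ _ _ _ _ kmul kmul_setT.

End kernel_product.

Section kernel_power.
Context {R : realType} {d} {X : measurableType d}.

Definition kmulp (k1 k2 : R.-pker X ~> X) : R.-pker X ~> X := kmul k1 k2.

Definition kid : R.-pker X ~> X := kdirac (@measurable_id _ X setT).

Fixpoint kpow (k : R.-pker X ~> X) (n : nat) : R.-pker X ~> X :=
  if n is n'.+1 then kmulp k (kpow k n') else kid.

End kernel_power.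

Definition mpushforward {R : realType} {d1 d2} {X : measurableType d1}
    {Y : measurableType d2} (m : {measure set X -> \bar R}) (f : X -> Y)
    (mf : measurable_fun setT f) : {measure set Y -> \bar R} :=
  measure_function_pushforward__canonical__measure_function_Measure m mf.

Section product_space.
Context {R : realType} {d} {T : measurableType d}.

Lemma measurable_set_coord (N : nat) (i : 'I_N) :
  measurable_fun setT (fun z : N.-tuple T * T => set_coord i z.1 z.2).
Proof.
apply/measurable_fun_tnthP => j; rewrite /comp /set_coord.
under eq_fun do rewrite tnth_mktuple.
case: eqP => _; first exact: measurable_snd.
by apply: (measurableT_comp (measurable_tnth j)); exact: measurable_fst.
Qed.

Lemma measurable_set_coordr (N : nat) (i : 'I_N) (x : N.-tuple T) :
  measurable_fun setT (set_coord i x).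
Proof.
exact: (measurableT_comp (measurable_set_coord i) (pair1_measurable x)).
Qed.

Section one_site.
Variables (N : nat) (i : 'I_N) (k : R.-pker (N.-tuple T) ~> T).

Definition resample (x : N.-tuple T) : {measure set (N.-tuple T) -> \bar R} :=
  mpushforward (k x) (measurable_set_coordr i x).

Let measurable_resample U : measurable U ->
  measurable_fun [set: N.-tuple T] (resample ^~ U).
Proof.
move=> mU.
pose A := (fun z : N.-tuple T * T => set_coord i z.1 z.2) @^-1` U.
have mA : measurable A.
  by rewrite -[A]setTI; exact: measurable_set_coord.
rewrite (_ : (fun x => resample x U) = (fun x => k x (xsection A x))).
  by apply: (measurable_fun_xsection_finite_kernel k); rewrite inE.
apply/funext => x; rewrite -[LHS]/(k x (set_coord i x @^-1` U)).
congr (Measure.sort (k x) _); apply/seteqP; split => u.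
  by rewrite /xsection/= inE.
by rewrite /xsection/= inE.
Qed.

HB.instance Definition _ := isKernel.Build _ _ _ _ R resample
  measurable_resample.

Let resample_setT x : resample x setT = 1%E.
Proof. exact: prob_kernel. Qed.

HB.instance Definition _ :=
  Kernel_isProbability.Build _ _ _ _ R resample resample_setT.

End one_site.

(* The big operator nests to the right in increasing order of i, and kmulp
   applies its left factor first: coordinate 0 is resampled first. *)
Definition gibbs_kernel (N : nat) (k : 'I_N -> R.-pker (N.-tuple T) ~> T) :
    R.-pker (N.-tuple T) ~> (N.-tuple T) :=
  \big[kmulp/kid]_(i < N) resample i (k i).

End product_space.

Section power_measure.
Context {R : realType} {d} {T : measurableType d}.

Definition cons_tuple_pair (n : nat) (z : T * n.-tuple T) : n.+1.-tuple T :=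
  [the n.+1.-tuple T of z.1 :: z.2].

Lemma measurable_cons_tuple_pair n : measurable_fun setT (@cons_tuple_pair n).
Proof. by apply: measurable_cons. Qed.

Variable m : {sigma_finite_measure set T -> \bar R}.

Section step.
Variables (n : nat) (mn : {sigma_finite_measure set (n.-tuple T) -> \bar R}).

Definition power_measure_step : set (n.+1.-tuple T) -> \bar R :=
  mpushforward (m \x mn)%E (@measurable_cons_tuple_pair n).

HB.instance Definition _ := Measure.on power_measure_step.

Let power_measure_step_sigma_finite : sigma_finite setT power_measure_step.
Proof.
have /sigma_finiteP[F [FT ndF Foo]] := sigma_finiteT m.
have /sigma_finiteP[G [GT ndG Goo]] := sigma_finiteT mn.
pose uncons (t : n.+1.-tuple T) : T * n.-tuple T := (thead t, [tuple of behead t]).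
have munc : measurable_fun setT uncons.
  apply: measurable_fun_pair; first exact: measurable_tnth.
  exact: measurable_behead.
have unconsK z : uncons (cons_tuple_pair z) = z.
  by case: z => a t; congr pair; apply/val_inj.
exists (fun i => uncons @^-1` (F i `*` G i)).
  apply/seteqP; split => // t _.
  have [j _ Fj] : (\bigcup_i F i) (thead t) by rewrite -FT.
  have [k _ Gk] : (\bigcup_i G i) [tuple of behead t] by rewrite -GT.
  exists (maxn j k) => //; split => /=.
  - by move: Fj; exact/subsetPset/ndF/leq_maxl.
  - by move: Gk; exact/subsetPset/ndG/leq_maxr.
move=> i; have [mF Fi] := Foo i; have [mG Gi] := Goo i; split.
  by rewrite -[X in measurable X]setTI; apply: munc => //; exact: measurableX.
rewrite -[X in (X < _)%E]/((m \x mn)%E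
  (@cons_tuple_pair n @^-1` (uncons @^-1` (F i `*` G i)))).
rewrite (_ : _ @^-1` _ = F i `*` G i); last first.
  rewrite -comp_preimage (_ : uncons \o _ = id) ?preimage_id//.
  by apply/funext => z; exact: unconsK.
by rewrite product_measure1E// lte_mul_pinfty// ge0_fin_numE.
Qed.

HB.instance Definition _ := Measure_isSigmaFinite.Build _ _ _
  power_measure_step power_measure_step_sigma_finite.

End step.

(* The product measure m^(x n) on T^n, built by adding one factor at a time. *)
Fixpoint power_measure (n : nat) :
    {sigma_finite_measure set (n.-tuple T) -> \bar R} :=
  if n is n'.+1 then power_measure_step (power_measure n')
  else \d_([tuple] : 0.-tuple T).

Lemma power_measure_box (n : nat) (A : 'I_n -> set T) :
  (forall i, measurable (A i)) ->
  power_measure n [set t | forall i, A i (tnth t i)] = (\prod_(i < n) m (A i))%E.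
Proof.
elim: n A => [|n IH] A mA.
  by rewrite big_ord0 /= diracE mem_set// => -[].
rewrite big_ord_recl -IH; last by move=> i; exact: mA.
set B := [set t : n.-tuple T | _].
have mB : measurable B.
  rewrite (_ : B = \bigcap_(i in [set: 'I_n]) ((@tnth _ _)^~ i @^-1` A (lift ord0 i))).
    apply: fin_bigcap_measurable => // i _.
    by rewrite -[X in measurable X]setTI; exact: measurable_tnth.
  by apply/seteqP; split => t Bt i; [move=> _|]; exact: Bt.
rewrite -product_measure1E//.
rewrite -[LHS]/((m \x power_measure n)%E (@cons_tuple_pair n @^-1`
  [set t : n.+1.-tuple T | forall i, A i (tnth t i)])).
congr product_measure1; apply/seteqP; split => -[a t] /=.
  move=> At; split => [|i /=]; first exact: (At ord0).
  by have := At (lift ord0 i); rewrite tnthS.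
move=> [/= Aa Bt] i; case: (unliftP ord0 i) => [j|] ->; last exact: Aa.
by rewrite tnthS; exact: Bt.
Qed.


End power_measure.

Section gibbs.
Local Open Scope ereal_scope.
Context {R : realType} {d} {T : measurableType d}.

Definition is_gibbs (N : nat) (m : {sigma_finite_measure set T -> \bar R})
    (V : N.-tuple T -> R) (mu : probability (N.-tuple T) R) : Prop :=
  let Z := \int[power_measure m N]_x (expR (- V x))%:E in
  [/\ measurable_fun setT V, 0 < Z, Z < +oo &
    forall A, measurable A ->
      mu A = Z^-1 * \int[power_measure m N]_(x in A) (expR (- V x))%:E].

(* The sigma-algebra generated by the coordinates other than i. *)
Definition sigma_off (N : nat) (i : 'I_N) : set (set (N.-tuple T)) :=
  <<s \bigcup_(j in [set j | j != i])
        preimage_set_system setT (fun x => tnth x j) measurable >>.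

Definition depends_off (N : nat) (i : 'I_N) (k : R.-pker (N.-tuple T) ~> T) :
    Prop :=
  forall x y, agree_off i x y -> forall A, measurable A -> k x A = k y A.

Definition is_conditional_law (N : nat) (mu : probability (N.-tuple T) R)
    (i : 'I_N) (k : R.-pker (N.-tuple T) ~> T) : Prop :=
  depends_off i k /\
  forall A B, measurable A -> sigma_off i B ->
    mu (B `&` (fun x => tnth x i) @^-1` A) = \int[mu]_(x in B) k x A.

(* Where the one-site normalization is infinite (a mu-null set of x) the
   quotient is meaningless and the version k is left unconstrained. *)
Definition gibbs_conditional_density (N : nat)
    (m : {sigma_finite_measure set T -> \bar R}) (V : N.-tuple T -> R)
    (i : 'I_N) (k : R.-pker (N.-tuple T) ~> T) : Prop :=
  forall x, let Zi := \int[m]_u (expR (- V (set_coord i x u)))%:E in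
    Zi < +oo ->
    forall A, measurable A ->
      k x A = Zi^-1 * \int[m]_(u in A) (expR (- V (set_coord i x u)))%:E.

Definition lipschitz_W1 (N : nat) (rho : T -> T -> R)
    (k : R.-pker (N.-tuple T) ~> T) : Prop :=
  exists L : R, forall x y, W1 rho (k x) (k y) <= (L * dL1 rho x y)%:E.

Definition dobrushin_coef (N : nat) (rho : T -> T -> R)
    (mui : 'I_N -> R.-pker (N.-tuple T) ~> T) (i j : 'I_N) : \bar R :=
  esup0 [set r | exists x y, [/\ agree_off j x y, tnth x j <> tnth y j &
    r = W1 rho (mui i x) (mui i y) / (rho (tnth x j) (tnth y j))%:E]].

(* Entries are nonnegative, so 0 is a neutral default for the maxima. *)
Definition matrix_norm1 (N : nat) (c : 'I_N -> 'I_N -> \bar R) : \bar R :=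
  \big[maxe/0]_(j < N) \sum_(i < N) c i j.

Definition matrix_normoo (N : nat) (c : 'I_N -> 'I_N -> \bar R) : \bar R :=
  \big[maxe/0]_(i < N) \sum_(j < N) c i j.

(* The factors are finite under the standing assumptions when r < 1 and f is
   Lipschitz. *)
Definition bias_const (N : nat) (rho : T -> T -> R)
    (mu : probability (N.-tuple T) R) (r : \bar R) (f : N.-tuple T -> R)
    (x : N.-tuple T) : R :=
  (fine r / (1 - fine r) *
   fine (\big[maxe/0]_(i < N)
     \int[mu]_y (rho (tnth x i) (tnth y i))%:E)%E *
   fine (\sum_(i < N) coord_osc rho f i)%E)%R.

Definition is_markov_chain {d1 d2} {X : measurableType d1}
    {Om : measurableType d2} (P : R.-pker X ~> X) (x : X)
    (Pr : probability Om R) (Z : nat -> {RV Pr >-> X}) : Prop :=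
  {ae Pr, forall w, Z 0%N w = x} /\
  forall n A B, measurable A ->
    g_sigma_preimage (fun k : 'I_n.+1 => Z k : Om -> X) B ->
    Pr (B `&` Z n.+1 @^-1` A) = \int[Pr]_(w in B) P (Z n w) A.

End gibbs.

(* Main.v *)
(**
A single-site law satisfying [T1] has sub-Gaussian Laplace transforms on
Lipschitz functions: apply the inequality to the tilted measure
[e^g beta / z], whose entropy is [int g - ln z] (Bobkov and Götze). Hence each
update of coordinate [i] costs at most [C1 a_i^2 / 2], where [a_i] is the
oscillation of the integrand in coordinate [i], while the Dobrushin coefficients
turn oscillations [a] into [a_j + c_ij a_i] for [j <> i], and [0] for [j = i].
When the columns of [C] sum to at most [r1], oscillations at most [m] before a
sweep stay below [m / (1 - r1)] during it and end below [m r1 / (1 - r1)]; as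
[r1 < 1/2] this contracts. Along the chain,
[G_0 = 0], [G_(k+1) = f + P G_k] therefore have oscillations at most
[alpha (1 - r1) / (1 - 2 r1)], which bounds the Laplace transform of the sum of
the [f (Z_k)], and Chernoff's bound gives (a). For (b), when the rows of [C] sum
to at most [r], a sweep multiplies the total oscillation by at most [r]; since
[mu] is invariant under [P], the bias is at most the sum of the [r^k] times
[max_i (int d(x^i, y^i) mu(dy)) * sum_i delta_i(f)].
*)
From HB Require Import structures.
Require Import Defs.
From mathcomp Require Import all_boot all_order all_algebra.
From mathcomp Require Import all_classical all_reals all_analysis.
From mathcomp Require Import measurable_realfun.
From mathcomp Require Import lra ring.
Set Implicit Arguments.
Unset Strict Implicit.
Unset Printing Implicit Defensive.
Import Order.TTheory GRing.Theory Num.Theory.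
Import numFieldNormedType.Exports.
Local Open Scope classical_set_scope.
Local Open Scope ring_scope.

(** * Extending integral identities from sets to nonnegative functions *)

Section nonnegative_integrals.
Local Open Scope ereal_scope.
Import HBNNSimple.

(** The standard machine: [nnsfun_approx] increases to [f], and each approximant is a finite sum of
    scaled indicators of its level sets. *)
Lemma ge0_measurable_ind (R : realType) d (T : measurableType d)
    (P : (T -> \bar R) -> Prop) :
  (forall A, measurable A -> P (EFin \o \1_A)) ->
  (forall (k : R) g, (0 <= k)%R -> measurable_fun setT g ->
    (forall x, 0 <= g x) -> P g -> P (fun x => k%:E * g x)) ->
  (forall g h, measurable_fun setT g -> measurable_fun setT h ->
    (forall x, 0 <= g x) -> (forall x, 0 <= h x) ->
    P g -> P h -> P (fun x => g x + h x)) ->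
  (forall g : (T -> \bar R)^nat, (forall n, measurable_fun setT (g n)) ->
    (forall n x, 0 <= g n x) ->
    (forall x, nondecreasing_seq (g ^~ x)) -> (forall n, P (g n)) ->
    P (fun x => limn (g ^~ x))) ->
  forall f, measurable_fun setT f -> (forall x, 0 <= f x) -> P f.
Proof.
move=> Pind Pscale Padd Plim f mf f0.
pose f_ := nnsfun_approx measurableT mf.
have -> : f = fun x => limn (fun n => (f_ n x)%:E).
  apply/funext => x; apply/esym/cvg_lim => //.
  exact: cvg_nnsfun_approx.
apply: Plim => [n|n x|x|n].
- exact/measurable_EFinP.
- by rewrite lee_fin.
- by move=> a b ab; rewrite lee_fin; exact/lefP/nd_nnsfun_approx.
- have mI (y : R) : measurable_fun setT (EFin \o \1_(f_ n @^-1` [set y]) : T -> \bar R).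
    by apply/measurable_EFinP; exact: measurable_indic.
  (* Measurability and nonnegativity are carried through the induction on the list of values because
     [Padd] asks for them at every partial sum. *)
  suff [H _ _] : [/\ P (fun x => \sum_(y <- finmap.enum_fset (fset_set (range (f_ n))))
      (y%:E * (EFin \o \1_(f_ n @^-1` [set y])) x)),
      measurable_fun setT (fun x => \sum_(y <- finmap.enum_fset (fset_set (range (f_ n))))
      (y%:E * (EFin \o \1_(f_ n @^-1` [set y])) x)) &
      forall x, 0 <= \sum_(y <- finmap.enum_fset (fset_set (range (f_ n))))
      (y%:E * (EFin \o \1_(f_ n @^-1` [set y])) x)].
    rewrite (_ : (fun x => _) = (fun x => \sum_(y <- finmap.enum_fset (fset_set (range (f_ n))))
      (y%:E * (EFin \o \1_(f_ n @^-1` [set y])) x)))//.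
    apply/funext => x; rewrite fimfunE -fsumEFin// fsbig_finite//=.
  have : all (fun y => (0 <= y)%R) (finmap.enum_fset (fset_set (range (f_ n)))).
    apply/allP => y; rewrite in_fset_set// inE => -[x _ <-].
    exact: fun_ge0.
  elim: (finmap.enum_fset _) => [_|y s IH /= /andP[y0 /IH [IH1 IH2 IH3]]].
    split => //.
    + rewrite (_ : (fun x => _) = EFin \o \1_(set0 : set T)).
        by apply: Pind; exact: measurable0.
      by apply/funext => x; rewrite big_nil /= indic0.
    + by under eq_fun do rewrite big_nil; exact: measurable_cst.
    + by move=> x; rewrite big_nil.
  have i0 x : 0 <= (EFin \o \1_(f_ n @^-1` [set y])) x by rewrite lee_fin.
  have mi : measurable_fun setT
      (fun x => y%:E * (EFin \o \1_(f_ n @^-1` [set y])) x).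
    exact: measurable_funeM.
  split.
  + under eq_fun do rewrite big_cons.
    apply: Padd => // [x|]; first by rewrite mule_ge0.
    apply: (Pscale _ (EFin \o \1_(f_ n @^-1` [set y]))) => //.
    by apply: Pind; rewrite -[X in measurable X]setTI; exact: measurable_funP.
  + by under eq_fun do rewrite big_cons; exact: emeasurable_funD.
  + by move=> x; rewrite big_cons; apply: adde_ge0 (IH3 x); exact: mule_ge0.
Qed.

(** The last hypothesis is the case of indicators, and the standard machine does the rest. One
    statement serves composition of kernels, invariance of a measure and the Markov property on an
    event of the past. *)
Lemma ge0_integral_mixture (R : realType) d1 d2 d3 (X : measurableType d1)
    (Y : measurableType d2) (Om : measurableType d3)
    (m : {measure set X -> \bar R}) (D : set X)
    (K : X -> {measure set Y -> \bar R})
    (M : {measure set Om -> \bar R}) (D' : set Om) (W : Om -> Y) :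
  measurable D -> measurable D' -> measurable_fun setT W ->
  (forall A, measurable A -> measurable_fun setT (K ^~ A)) ->
  (forall A, measurable A -> M (D' `&` W @^-1` A) = \int[m]_(x in D) K x A) ->
  forall g, measurable_fun setT g -> (forall y, 0 <= g y) ->
  \int[M]_(w in D') g (W w) = \int[m]_(x in D) \int[K x]_y g y.
Proof.
move=> mD mD' mW mK ME.
have mKg (g : Y -> \bar R) : (forall y, 0 <= g y) -> measurable_fun setT g ->
    measurable_fun D (fun x => \int[K x]_y g y).
  by move=> g0 mg; apply: measurable_funTS; exact: measurable_fun_integral_kernel.
have mgW (g : Y -> \bar R) : measurable_fun setT g -> measurable_fun D' (g \o W).
  by move=> mg; apply: measurable_funTS; exact: measurableT_comp.
apply: ge0_measurable_ind => [A mA|k g k0 mg g0 IH|g h mg mh g0 h0 IHg IHh|].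
- rewrite [LHS](_ : _ = M (W @^-1` A `&` D')); last first.
    rewrite -integral_indic//.
    by rewrite -[X in measurable X]setTI; exact: mW.
  rewrite setIC ME//.
  by apply: eq_integral => x _; rewrite integral_indic// setIT.
- have E : \int[m]_(x in D) (k%:E * \int[K x]_y g y) =
           k%:E * \int[m]_(x in D) \int[K x]_y g y.
    by apply: ge0_integralZl => [//||x _|//]; [exact: mKg|exact: integral_ge0].
  have E' : \int[M]_(w in D') (k%:E * g (W w)) = k%:E * \int[M]_(w in D') g (W w).
    by apply: ge0_integralZl => [//||x _|//]; [exact: (mgW g)|exact: g0].
  rewrite E' IH -E; apply: eq_integral => x _.
  by apply/esym; apply: ge0_integralZl.
- have E : \int[m]_(x in D) (\int[K x]_y g y + \int[K x]_y h y) =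
     \int[m]_(x in D) \int[K x]_y g y + \int[m]_(x in D) \int[K x]_y h y.
    apply: ge0_integralD => [//|x _||x _|];
      by [exact: integral_ge0|exact: mKg].
  have E' : \int[M]_(w in D') (g (W w) + h (W w)) =
     \int[M]_(w in D') g (W w) + \int[M]_(w in D') h (W w).
    by apply: ge0_integralD => [//|x _||x _|];
      [exact: g0|exact: (mgW g)|exact: h0|exact: (mgW h)].
  rewrite E' IHg IHh -E; apply: eq_integral => x _.
  by apply/esym; apply: ge0_integralD.
- move=> g mg g0 ndg IH.
  have E' : \int[M]_(w in D') limn (g ^~ (W w)) = limn (fun n => \int[M]_(w in D') g n (W w)).
    apply: (@monotone_convergence _ _ _ M D' mD' (fun n w => g n (W w))).
    + by move=> n; exact: (mgW (g n)).
    + by move=> n x _; exact: g0.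
    + by move=> x _; exact: ndg.
  rewrite E'; under eq_fun do rewrite IH.
  rewrite -monotone_convergence//.
  + by apply: eq_integral => x _; rewrite monotone_convergence// => y _; exact: ndg.
  + by move=> n; exact: mKg.
  + by move=> n x _; exact: integral_ge0.
  + by move=> x _ a b ab; apply: ge0_le_integral => // y _; exact: ndg.
Qed.

(** A weak form of conditional expectation given [S]: equality of the integrals over events of [S]
    extends to weights that are functions of [S]. *)
Lemma ge0_integral_test (R : realType) d1 d2 (X : measurableType d1)
    (Y : measurableType d2) (m : {measure set X -> \bar R}) (S : X -> Y)
    (h1 h2 : X -> \bar R) :
  measurable_fun setT S -> measurable_fun setT h1 -> measurable_fun setT h2 ->
  (forall x, 0 <= h1 x) -> (forall x, 0 <= h2 x) ->
  (forall x, h1 x \is a fin_num) -> (forall x, h2 x \is a fin_num) ->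
  (forall B, measurable B ->
    \int[m]_(x in S @^-1` B) h1 x = \int[m]_(x in S @^-1` B) h2 x) ->
  forall g, measurable_fun setT g -> (forall y, 0 <= g y) ->
  \int[m]_x (g (S x) * h1 x) = \int[m]_x (g (S x) * h2 x).
Proof.
move=> mS mh1 mh2 h10 h20 fh1 fh2 h12.
have mgh (g : Y -> \bar R) h : measurable_fun setT g -> measurable_fun setT h ->
    measurable_fun setT (fun x => g (S x) * h x).
  move=> mg mh; apply: emeasurable_funM => //; exact: measurableT_comp.
apply: ge0_measurable_ind => [A mA|k g k0 mg g0 IH|g h mg mh g0 h0 IHg IHh|].
- have E h : \int[m]_x ((EFin \o \1_A) (S x) * h x) = \int[m]_(x in S @^-1` A) h x.
    rewrite [RHS]integral_mkcond; apply: eq_integral => x _.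
    by rewrite epatch_indic muleC.
  by rewrite !E h12.
- under eq_integral do rewrite -muleA.
  under [RHS]eq_integral do rewrite -muleA.
  rewrite !ge0_integralZl ?IH ?lee_fin//; solve [exact: mgh|by move=> x _; rewrite mule_ge0].
- under eq_integral do rewrite ge0_muleDl//.
  under [RHS]eq_integral do rewrite ge0_muleDl//.
  rewrite !ge0_integralD ?IHg ?IHh//; solve [exact: mgh|by move=> x _; rewrite mule_ge0].
- move=> g mg g0 ndg IH.
  have E h : measurable_fun setT h -> (forall x, 0 <= h x) ->
      (forall x, h x \is a fin_num) ->
      \int[m]_x (limn (g ^~ (S x)) * h x) =
      limn (fun n => \int[m]_x (g n (S x) * h x)).
    move=> mh h0 fh; rewrite -monotone_convergence//; first last.
    + by move=> x _ a b ab; rewrite lee_wpmul2r//; exact: ndg.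
    + by move=> n x _; rewrite mule_ge0.
    + by move=> n; exact: mgh.
    apply: eq_integral => x _; apply/esym/cvg_lim => //.
    (* Finiteness of [h x] is what lets the monotone limit pass through the product. *)
    by apply: cvgeZr => //; exact: ereal_nondecreasing_is_cvgn.
  rewrite (E _ mh1 h10 fh1) (E _ mh2 h20 fh2).
  by congr (limn _); apply/funext => n; exact: IH.
Qed.

End nonnegative_integrals.

(** * Lipschitz functions and the easy half of Kantorovich duality *)

Section transport_duality.
Context {R : realType} {dT : measure_display} {T : measurableType dT}.
Variables (rho : T -> T -> R) (hrho : is_metric rho).
Hypothesis mrho : measurable_fun setT (fun z : T * T => rho z.1 z.2).

Lemma measurable_metric1 x0 : measurable_fun setT (rho x0).
Proof. exact: (measurableT_comp mrho (pair1_measurable x0)). Qed.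

Lemma finite_momentP (nu : probability T R) : finite_moment rho nu ->
  forall x0, nu.-integrable setT (EFin \o rho x0).
Proof.
case: hrho => d0 _ dC dt [y0 hy0] x0.
have I : nu.-integrable setT (EFin \o rho y0).
  apply/integrableP; split.
    by apply/measurable_EFinP; exact: measurable_metric1.
  by under eq_integral do rewrite /= ger0_norm//.
apply: (@le_integrable _ _ _ _ _ _ _ (fun x => (rho x0 y0)%:E + (rho y0 x)%:E)%E) => //.
- by apply/measurable_EFinP; exact: measurable_metric1.
- by move=> x _; rewrite /= !ger0_norm ?addr_ge0// lee_fin.
- by apply: integrableD => //; exact: finite_measure_integrable_cst.
Qed.

Lemma lip_integrable (nu : probability T R) (g : T -> R) (a : R) :
  finite_moment rho nu -> measurable_fun setT g ->
  (forall x y, `|g x - g y| <= a * rho x y) ->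
  nu.-integrable setT (EFin \o g).
Proof.
move=> hnu mg hg; have [x0 _] := hnu.
have I := finite_momentP hnu x0.
apply: (@le_integrable _ _ _ _ _ _ _
  (fun x => `|g x0|%:E + a%:E * (rho x0 x)%:E)%E) => //.
- exact/measurable_EFinP.
- move=> x _; rewrite /= lee_fin; apply: le_trans (ler_norm _).
  by rewrite -lerBlDl (le_trans (lerB_dist _ _))// distrC.
- apply: integrableD => //; first exact: finite_measure_integrable_cst.
  exact: integrableZl.
Qed.

(** Along a coupling the difference of the two integrals becomes the integral of [g z.2 - g z.1],
    which is at most [a] times the transport cost. *)
Lemma lip_W1 (nu1 nu2 : {measure set T -> \bar R}) (g : T -> R) (a w : R) :
  0 <= a -> measurable_fun setT g ->
  (forall x y, `|g x - g y| <= a * rho x y) ->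
  nu1.-integrable setT (EFin \o g) -> nu2.-integrable setT (EFin \o g) ->
  (W1 rho nu1 nu2 <= w%:E)%E ->
  \int[nu2]_x g x - \int[nu1]_x g x <= a * w.
Proof.
case: hrho => d0 _ _ _ a0 mg hg I1 I2 hw.
(* The infimum over couplings need not be attained, so a coupling of cost below [w + e] is used and
   [e] is sent to [0]. Taking [e / a] absorbs the factor [a], which sets [a = 0] apart. *)
suff H (e : R) : 0 < e -> \int[nu2]_x g x - \int[nu1]_x g x <= a * (w + e).
  move: a0; rewrite le_eqVlt => /predU1P[a0|a0].
    by move: (H 1 ltr01); rewrite -a0 !mul0r.
  apply/ler_addgt0Pr => e e0.
  by rewrite (le_trans (H (e / a) _)) ?divr_gt0// mulrDr mulrCA divff ?mulr1// gt_eqF.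
move=> e0.
have : (W1 rho nu1 nu2 < (w + e)%:E)%E.
  by apply: le_lt_trans hw _; rewrite lte_fin ltrDl.
move=> /ereal_inf_lt[_ [gam hgam <-]] hlt.
have pf (nu : {measure set T -> \bar R}) (p : T * T -> T) (mp : measurable_fun setT p) :
    (forall A, measurable A -> gam (p @^-1` A) = nu A) ->
    nu.-integrable setT (EFin \o g) ->
    gam.-integrable setT (EFin \o (g \o p)) /\
    \int[nu]_x g x = \int[gam]_z g (p z).
  move=> hp I.
  have mgp : measurable_fun setT (EFin \o (g \o p)).
    by apply/measurable_EFinP; exact: measurableT_comp.
  have J : gam.-integrable setT (EFin \o (g \o p)).
    apply/integrableP; split => //.
    have -> : (\int[gam]_x `|(EFin \o (g \o p)) x| =
        \int[pushforward gam p]_x `|(EFin \o g) x|)%E.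
      rewrite ge0_integral_pushforward//.
      by apply: measurableT_comp => //; exact/measurable_EFinP.
    case/integrableP : I => _; apply: le_lt_trans.
    suff -> : (\int[pushforward gam p]_x `|(EFin \o g) x| =
      \int[nu]_x `|(EFin \o g) x|)%E by [].
    by apply: eq_measure_integral => A mA _; rewrite -hp.
  split => //; rewrite /Rintegral; congr fine.
  transitivity (\int[pushforward gam p]_x (EFin \o g) x)%E.
    by apply: eq_measure_integral => A mA _; rewrite -hp.
  by rewrite integral_pushforward//; exact/measurable_EFinP.
have [J1 E1] := pf nu1 fst measurable_fst (fun A mA => (hgam A mA).1) I1.
have [J2 E2] := pf nu2 snd measurable_snd (fun A mA => (hgam A mA).2) I2.
rewrite E1 E2 -RintegralB//.
have Ir : gam.-integrable setT (EFin \o (fun z => rho z.1 z.2)).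
  apply/integrableP; split; first exact/measurable_EFinP.
  under eq_integral do rewrite /= ger0_norm//.
  by rewrite (lt_trans hlt) ?ltry.
have Ii : (\int[gam]_z (rho z.1 z.2)%:E)%E = (\int[gam]_z rho z.1 z.2)%:E.
  by rewrite fineK//; exact: integrable_fin_num.
move: hlt; rewrite Ii lte_fin => /ltW hle.
apply: le_trans (ler_wpM2l a0 hle).
rewrite -RintegralZl//; apply: le_Rintegral => //.
- exact: (integrableB _ J2 J1).
- exact: (integrableZl _ _ Ir).
- by move=> z _; rewrite (le_trans (ler_norm _))// distrC.
Qed.

End transport_duality.

(** * Change of measure by a density *)

Section tilting.
Context {R : realType} {dT : measure_display} {T : measurableType dT}.
Variables (beta : probability T R) (h : T -> R).
Hypotheses (mh : measurable_fun setT h) (h0 : forall x, 0 <= h x)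
  (h1 : (\int[beta]_x (h x)%:E = 1)%E).
Local Open Scope ereal_scope.

Definition tilted : set T -> \bar R := fun A => \int[beta]_(x in A) (h x)%:E.

Let tilted0 : tilted set0 = 0. Proof. exact: integral_set0. Qed.

Let tilted_ge0 A : 0 <= tilted A.
Proof. by apply: integral_ge0 => x _; rewrite lee_fin. Qed.

Let tilted_sigma_additive : semi_sigma_additive tilted.
Proof.
apply: semi_sigma_additive_nng_induced; first exact/measurable_EFinP.
by move=> x; rewrite lee_fin.
Qed.

HB.instance Definition _ := isMeasure.Build _ _ _ tilted
  tilted0 tilted_ge0 tilted_sigma_additive.

Let tiltedT : tilted setT = 1. Proof. exact: h1. Qed.

HB.instance Definition _ := Measure_isProbability.Build _ _ _ tilted tiltedT.

Definition tilted_probability : probability T R := tilted.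

Lemma tilted_dominated : tilted_probability `<< beta.
Proof.
apply/null_content_dominatesP => A mA A0.
rewrite /tilted_probability/= /tilted null_set_integral//.
by apply: measurable_funTS; exact/measurable_EFinP.
Qed.

(** Both sides have the same integral over every measurable set, which determines a density up to a
    [beta]-null set. *)
Lemma tilted_density : ae_eq beta setT
  (Radon_Nikodym (charge_of_finite_measure tilted_probability) beta) (EFin \o h).
Proof.
apply: integral_ae_eq => //.
- by apply: Radon_Nikodym_integrable; exact: tilted_dominated.
- exact/measurable_EFinP.
- by move=> A _ mA; rewrite -Radon_Nikodym_integral//; exact: tilted_dominated.
Qed.

Lemma integral_tilted (k : T -> R) : tilted_probability.-integrable setT (EFin \o k) ->
  \int[tilted_probability]_x (k x)%:E = \int[beta]_x (k x * h x)%:E.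
Proof.
move=> Ik; have td := tilted_dominated.
rewrite -(Radon_Nikodym_change_of_variables td measurableT Ik)/=.
have mk : measurable_fun setT k.
  by apply/measurable_EFinP; exact: measurable_int Ik.
apply: ae_eq_integral => //.
- apply: emeasurable_funM; first exact/measurable_EFinP.
  by apply: (measurable_int beta); exact: Radon_Nikodym_integrable.
- by apply/measurable_EFinP; exact: measurable_funM.
- apply: filterS tilted_density => x /(_ Logic.I) /= -> _.
  by rewrite EFinM.
Qed.

End tilting.

(** * Truncation, and Laplace transforms under a transport inequality *)

Lemma ler_dist_max {R : realDomainType} (k u v : R) :
  `|Num.max k u - Num.max k v| <= `|u - v|.
Proof.
rewrite ler_norml; case: (leP k u) => h1; case: (leP k v) => h2;
  case: (ler0P (u - v)) => h3; lra.
Qed.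

Lemma ler_dist_min {R : realDomainType} (k u v : R) :
  `|Num.min k u - Num.min k v| <= `|u - v|.
Proof.
rewrite ler_norml; case: (leP k u) => h1; case: (leP k v) => h2;
  case: (ler0P (u - v)) => h3; lra.
Qed.

Section laplace_transform.
Context {R : realType} {dT : measure_display} {T : measurableType dT}.

Lemma bounded_integrable (nu : probability T R) (g : T -> R) (b : R) :
  measurable_fun setT g -> (forall x, `|g x| <= b) ->
  nu.-integrable setT (EFin \o g).
Proof.
move=> mg gb.
apply: (@le_integrable _ _ _ _ _ _ _ (cst b%:E)) => //.
- exact/measurable_EFinP.
- by move=> x _; rewrite /= lee_fin (le_trans (gb x))// ler_norm.
- exact: finite_measure_integrable_cst.
Qed.

Lemma measurable_lne_EFin (u : T -> R) : measurable_fun setT u ->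
  measurable_fun setT (fun x => lne (u x)%:E).
Proof.
move=> mu; pose v x : \bar R := if 0 < u x then (ln (u x))%:E else -oo%E.
rewrite (_ : (fun x => _) = v).
  apply: measurable_fun_ifT => //; first exact: measurable_fun_ltr.
  by apply/measurable_EFinP; exact: measurableT_comp.
apply/funext => x; rewrite /v; case: ltP => u0; first by rewrite lne_EFin.
by rewrite le0_lneNy.
Qed.

(** The density of the tilted law is almost everywhere [expR l], so its logarithm is [l];
    boundedness of [l] gives the integrability. *)
Lemma relative_entropy_tilted (beta : probability T R) (l : T -> R) (b : R)
    (ml : measurable_fun setT l)
    (h1 : (\int[beta]_x (expR (l x))%:E = 1)%E) :
  (forall x, `|l x| <= b) ->
  exists nu : probability T R,
   (forall (k : T -> R) (c : R), measurable_fun setT k -> (forall x, `|k x| <= c) ->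
     \int[nu]_x k x = \int[beta]_x (k x * expR (l x))) /\
   relative_entropy nu beta = (\int[nu]_x l x)%:E.
Proof.
move=> lb.
have mh : measurable_fun setT (expR \o l) by exact: measurableT_comp.
have h0 x : 0 <= (expR \o l) x by exact: expR_ge0.
pose nu := tilted_probability mh h0 h1.
exists nu; split => [k c mk kc|].
  congr fine; apply: integral_tilted.
  exact: (bounded_integrable nu mk kc).
have td := tilted_dominated mh h0 h1.
rewrite /relative_entropy; case: asboolP => [|/(_ td)//] _.
rewrite /Rintegral fineK; last first.
  by apply: integrable_fin_num => //; exact: (bounded_integrable nu ml lb).
apply: ae_eq_integral => //.
- pose u x := fine (Radon_Nikodym (charge_of_finite_measure nu) beta x).
  rewrite (_ : (fun x => _) = fun x => lne (u x)%:E).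
    apply: measurable_lne_EFin.
    apply: (measurableT_comp (@fine_measurable R _ measurableT)).
    by apply: (measurable_int beta); exact: Radon_Nikodym_integrable.
  by apply/funext => x; rewrite /u fineK//; exact: Radon_Nikodym_fin_num.
- exact/measurable_EFinP.
(* The densities agree [beta]-almost everywhere, while the entropy integral is taken under [nu];
   domination transfers the equality. *)
- apply: (null_dominates_ae_eq measurableT td).
  apply: filterS (tilted_density mh h0 h1) => x /(_ Logic.I) /= -> _.
  by rewrite lne_EFin ?expR_gt0// expRK.
Qed.

Variables (rho : T -> T -> R) (hrho : is_metric rho).
Hypothesis mrho : measurable_fun setT (fun z : T * T => rho z.1 z.2).

(** With [nu] the tilted law and [H] its entropy, [ln z] is the [nu]-mean of [g] minus [H].
    Transport bounds this by the [beta]-mean of [g] plus [a * s - s ^+ 2 / (2 * c)], where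
    [s ^+ 2 = 2 * c * H]; completing the square in [s] leaves at most [c * a ^+ 2 / 2]. *)
Lemma T1_laplace_bounded (c : R) (beta : probability T R) (g : T -> R) (a b : R) :
  0 < c -> T1_ineq rho c beta -> measurable_fun setT g ->
  (forall x, `|g x| <= b) -> 0 <= a ->
  (forall x y, `|g x - g y| <= a * rho x y) ->
  (\int[beta]_x (expR (g x))%:E <= (expR (\int[beta]_x g x + c * a ^+ 2 / 2))%:E)%E.
Proof.
move=> c0 hT mg gb a0 hg.
have meg : measurable_fun setT (fun x => expR (g x)) by exact: measurableT_comp.
have egb x : `|expR (g x)| <= expR b.
  by rewrite ger0_norm ?expR_ge0// ler_expR (le_trans (ler_norm _)).
have Ieg := bounded_integrable beta meg egb.
pose z := \int[beta]_x (expR (g x)).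
have zE : (\int[beta]_x (expR (g x))%:E)%E = z%:E.
  by rewrite /z fineK//; exact: integrable_fin_num.
have one : \int[beta]_x (1:R) = 1.
  by rewrite Rintegral_cst// [X in fine X]probability_setT mul1r.
have Icst (k : R) : beta.-integrable setT (EFin \o cst k).
  exact: finite_measure_integrable_cst.
have z0 : 0 < z.
  apply: (lt_le_trans (expR_gt0 (- b))).
  have -> : expR (- b) = \int[beta]_x (cst (expR (- b)) x).
    by rewrite Rintegral_cst// [X in fine X]probability_setT mulr1.
  apply: le_Rintegral => // x _; rewrite ler_expR.
  by move: (gb x); rewrite ler_norml => /andP[].
pose l x := g x - ln z.
have elE x : expR (l x) = z^-1 * expR (g x).
  by rewrite /l expRD expRN lnK// mulrC.
have ml : measurable_fun setT l by exact: measurable_funB.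
have lb x : `|l x| <= b + `|ln z|.
  by rewrite (le_trans (ler_normB _ _))// lerD2r.
have h1 : (\int[beta]_x (expR (l x))%:E = 1)%E.
  under eq_integral do rewrite elE EFinM.
  rewrite integralZl// zE -EFinM mulVf//; exact: lt0r_neq0.
have [nu [nuE nuH]] := relative_entropy_tilted ml h1 lb.
have nu1 : \int[nu]_x (1:R) = 1.
  by rewrite Rintegral_cst// [X in fine X]probability_setT mul1r.
have Inu (k : T -> R) (q : R) : measurable_fun setT k -> (forall x, `|k x| <= q) ->
  nu.-integrable setT (EFin \o k) by move=> mk; exact: bounded_integrable.
pose H := \int[nu]_x l x.
have HE : H = \int[nu]_x g x - ln z.
  rewrite /H RintegralB//; [|exact: Inu gb|exact: finite_measure_integrable_cst].
  by rewrite Rintegral_cst// [X in fine X]probability_setT mulr1.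
(* Integrate [1 - expR (- l x) <= l x] under [nu]: the left side has integral [0] since [expR (- l)]
   cancels the density. The sign of [H] is required to square the root below. *)
have H0 : 0 <= H.
  have meNl : measurable_fun setT (fun x => expR (- l x)).
    by apply: measurableT_comp => //; exact: measurableT_comp.
  have eNlb x : `|expR (- l x)| <= expR (b + `|ln z|).
    rewrite ger0_norm ?expR_ge0// ler_expR (le_trans _ (lb x))//.
    by rewrite -normrN ler_norm.
  have -> : 0 = \int[nu]_x (1 - expR (- l x)).
    rewrite RintegralB//; [|exact: finite_measure_integrable_cst|exact: Inu eNlb].
    rewrite nu1 (nuE _ _ meNl eNlb).
    under eq_Rintegral do rewrite -expRD addNr expR0.
    by rewrite one subrr.
  apply: le_Rintegral => //.
  - exact: (integrableB measurableT
      (finite_measure_integrable_cst nu 1 measurableT) (Inu _ _ meNl eNlb)).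
  - exact: Inu lb.
  - move=> x _; have := expR_ge1Dx (- l x); lra.
have hW : (W1 rho beta nu <= (Num.sqrt (2 * c * H))%:E)%E.
  by have := hT nu; rewrite nuH -EFinM.
have := lip_W1 hrho mrho a0 mg hg (bounded_integrable beta mg gb) (Inu _ _ mg gb) hW.
set s := Num.sqrt _ => hs.
have s2 : s ^+ 2 = 2 * c * H by rewrite sqr_sqrtr// !mulr_ge0// ltW.
rewrite zE lee_fin -[leLHS]lnK// ler_expR.
have lnE : ln z = \int[nu]_x g x - H by rewrite HE; ring.
rewrite lnE.
have c2 : H = s ^+ 2 / (2 * c) by rewrite s2 mulrAC divff ?mul1r// mulf_neq0 ?lt0r_neq0.
suff : a * s - H <= c * a ^+ 2 / 2 by lra.
rewrite c2 -subr_ge0.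
have -> : c * a ^+ 2 / 2 - (a * s - s ^+ 2 / (2 * c)) = (s - c * a) ^+ 2 / (2 * c).
  by field; exact: lt0r_neq0.
by rewrite divr_ge0 ?sqr_ge0// mulr_ge0// ltW.
Qed.

(** Truncating [g] to [[-n, n]] preserves its Lipschitz constant. The bounded case passes to the
    limit by Fatou on the exponentials and dominated convergence on the means. *)
Lemma T1_laplace (c : R) (beta : probability T R) (g : T -> R) (a : R) :
  0 < c -> T1_ineq rho c beta -> measurable_fun setT g ->
  beta.-integrable setT (EFin \o g) -> 0 <= a ->
  (forall x y, `|g x - g y| <= a * rho x y) ->
  (\int[beta]_x (expR (g x))%:E <= (expR (\int[beta]_x g x + c * a ^+ 2 / 2))%:E)%E.
Proof.
move=> c0 hT mg Ig a0 hg.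
pose t (n : nat) x := Num.max (- n%:R) (Num.min n%:R (g x)).
have mt n : measurable_fun setT (t n).
  by apply: measurable_maxr => //; exact: measurable_minr.
have tb n x : `|t n x| <= n%:R.
  rewrite /t ler_norml le_max lexx/= ge_max ge_min lexx andbT.
  by rewrite (le_trans _ (ler0n _ _))// oppr_le0.
have tg n x : `|t n x| <= `|g x|.
  have n0 := ler0n R n.
  rewrite /t ler_norml; case: (leP n%:R (g x)) => h1;
    [case: (leP (- n%:R) n%:R) => h2|case: (leP (- n%:R) (g x)) => h2];
    case: (ler0P (g x)) => h3; lra.
have tl n x y : `|t n x - t n y| <= a * rho x y.
  by apply: le_trans (hg x y); apply: le_trans (ler_dist_max _ _ _) (ler_dist_min _ _ _).
have tc x : \forall n \near \oo, t n x = g x.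
  near=> n.
  have : `|g x| <= n%:R by near: n; exact: nbhs_infty_ger.
  rewrite ler_norml /t => /andP[h1 h2].
  by rewrite min_r// max_r.
have cI : (\int[beta]_x (t n x)%:E)%E @[n --> \oo] --> (\int[beta]_x (g x)%:E)%E.
  have mtE n : measurable_fun setT (fun x => (t n x)%:E).
    exact/measurable_EFinP.
  have tcE x : (t n x)%:E @[n --> \oo] --> (g x)%:E.
    by apply: cvg_near_cst; apply: filterS (tc x) => n ->.
  have [//|//|_ _] := @dominated_convergence _ _ _ beta setT measurableT
    (fun n x => (t n x)%:E) (EFin \o g) (fun x => `|(g x)%:E|)%E mtE
    (measurable_int _ Ig) _ (integrable_abse Ig).
  - by apply: aeW => x _; exact: tcE.
  - by apply: aeW => x n _; rewrite lee_fin.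
  - by [].
(* At each point the truncations are eventually equal to [g x], so the lower limit in Fatou's lemma
   is the integrand itself. *)
apply: (@le_trans _ _ (\int[beta]_x limn_einf (fun n => (expR (t n x))%:E))%E).
  rewrite le_eqVlt; apply/orP; left; apply/eqP.
  apply: eq_integral => x _; apply/esym.
  apply: (cvg_limn_einf_sup _).1; apply: cvg_near_cst.
  by apply: filterS (tc x) => n ->.
have mexp n : measurable_fun setT (fun x => (expR (t n x))%:E).
  by apply/measurable_EFinP; exact: measurableT_comp.
have exp0 n x : setT x -> (0 <= (expR (t n x))%:E)%E.
  by rewrite lee_fin expR_ge0.
apply: (le_trans (fatou beta measurableT mexp exp0)).
have cr : (expR (\int[beta]_x t n x + c * a ^+ 2 / 2))%:E @[n --> \oo] -->
   (expR (\int[beta]_x g x + c * a ^+ 2 / 2))%:E.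
  apply: cvg_EFin; first exact: nearW.
  apply: continuous_cvg; first exact: continuous_expR.
  apply: cvgD; last exact: cvg_cst.
  apply: fine_cvg; rewrite /Rintegral fineK//; exact: integrable_fin_num.
rewrite limn_einf_lim -(cvg_lim _ cr)//.
apply: lee_lim; [exact: is_cvg_einfs|by apply/cvg_ex; eexists; exact: cr|].
apply: nearW => n.
apply: le_trans (T1_laplace_bounded c0 hT (mt n) (tb n) a0 (tl n)).
by apply: ereal_inf_lbound; exists n => /=.
Unshelve. all: by end_near. Qed.

End laplace_transform.

(** * Integration against kernels and their compositions *)

Lemma measurable_Rintegral_kernel {R : realType} {d1 d2 : measure_display}
    {X : measurableType d1} {Y : measurableType d2} (K : R.-pker X ~> Y) (f : Y -> R) :
  measurable_fun setT f -> measurable_fun setT (fun x => \int[K x]_y f y).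
Proof.
move=> mf; apply: (measurableT_comp (@fine_measurable R _ measurableT)).
have mE : measurable_fun setT (EFin \o f) by exact/measurable_EFinP.
rewrite (_ : (fun x => _) = (fun x => \int[K x]_y ((EFin \o f)^\+ y) -
  \int[K x]_y ((EFin \o f)^\- y)))%E; last first.
  by apply/funext => x; rewrite integralE.
apply: emeasurable_funB; apply: measurable_fun_integral_kernel => //.
- by move=> A mA; exact: measurable_kernel.
- exact: measurable_funepos.
- by move=> A mA; exact: measurable_kernel.
- exact: measurable_funeneg.
Qed.

Section kernel_integrals.
Context {R : realType} {d1 d2 d3 : measure_display} {X : measurableType d1}
  {Y : measurableType d2} {Z : measurableType d3}.

Lemma ge0_integral_kmul (K1 : R.-pker X ~> Y) (K2 : R.-pker Y ~> Z) x
    (g : Z -> \bar R) : measurable_fun setT g -> (forall z, (0 <= g z)%E) ->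
  (\int[kmul K1 K2 x]_z g z = \int[K1 x]_y \int[K2 y]_z g z)%E.
Proof.
move=> mg g0.
apply: (@ge0_integral_mixture R _ _ _ Y Z Z (K1 x) setT K2 (kmul K1 K2 x) setT id) => //.
- by move=> A mA; exact: measurable_kernel.
- by move=> A mA; rewrite setTI.
Qed.

(** Signed integrands are reduced to nonnegative ones through [f = (f + |f|) - |f|]: the identity is
    proved for [f + |f|] and for [|f|], then the latter is cancelled. *)
Lemma Rintegral_kmul (K1 : R.-pker X ~> Y) (K2 : R.-pker Y ~> Z) x (f : Z -> R) :
  measurable_fun setT f -> (forall y, (K2 y).-integrable setT (EFin \o f)) ->
  (K1 x).-integrable setT (EFin \o (fun y => \int[K2 y]_z `|f z|)) ->
  (kmul K1 K2 x).-integrable setT (EFin \o f) /\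
  \int[kmul K1 K2 x]_z f z = \int[K1 x]_y \int[K2 y]_z f z.
Proof.
move=> mf I2 I1.
have mE : measurable_fun setT (EFin \o f) by exact/measurable_EFinP.
have main (h : Z -> R) : measurable_fun setT h -> (forall z, 0 <= h z) ->
    (forall y, (K2 y).-integrable setT (EFin \o h)) ->
    (K1 x).-integrable setT (EFin \o (fun y => \int[K2 y]_z h z)) ->
    (\int[kmul K1 K2 x]_z (h z)%:E)%E = (\int[K1 x]_y \int[K2 y]_z h z)%:E.
  move=> mh h0 J2 J1.
  rewrite ge0_integral_kmul//; last exact/measurable_EFinP.
  rewrite fineK; last exact: integrable_fin_num.
  apply: eq_integral => y _; rewrite fineK//; exact: integrable_fin_num.
have mn : measurable_fun setT (fun z => `|f z|) by exact: measurableT_comp.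
have I2n y : (K2 y).-integrable setT (EFin \o (fun z => `|f z|)).
  exact: (integrable_abse (I2 y)).
have En := main _ mn (fun z => normr_ge0 _) I2n I1.
have If : (kmul K1 K2 x).-integrable setT (EFin \o f).
  by apply/integrableP; split => //; rewrite [X in (X < _)%E]En ltry.
split => //.
have mg : measurable_fun setT (fun z => f z + `|f z|) by exact: measurable_funD.
have g0 z : 0 <= f z + `|f z| by rewrite -lerBlDl sub0r -normrN ler_norm.
have I2g y : (K2 y).-integrable setT (EFin \o (fun z => f z + `|f z|)).
  exact: (integrableD measurableT (I2 y) (I2n y)).
have gE y : \int[K2 y]_z (f z + `|f z|) = \int[K2 y]_z f z + \int[K2 y]_z `|f z|.
  exact: RintegralD.
have I1f : (K1 x).-integrable setT (EFin \o (fun y => \int[K2 y]_z f z)).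
  apply: (le_integrable measurableT _ _ I1).
    by apply/measurable_EFinP; exact: measurable_Rintegral_kernel.
  move=> y _; rewrite /= lee_fin.
  by apply: le_trans (le_normr_Rintegral _ _) (ler_norm _).
have I1g : (K1 x).-integrable setT (EFin \o (fun y => \int[K2 y]_z (f z + `|f z|))).
  under eq_fun do rewrite gE.
  exact: (integrableD measurableT I1f I1).
have Eg := main _ mg g0 I2g I1g.
have In : (kmul K1 K2 x).-integrable setT (EFin \o (fun z => `|f z|)).
  exact: (integrable_abse If).
have : \int[kmul K1 K2 x]_z (f z + `|f z|) = \int[K1 x]_y \int[K2 y]_z (f z + `|f z|).
  by rewrite {1}/Rintegral Eg.
rewrite RintegralD//; under [RHS]eq_Rintegral do rewrite gE.
rewrite RintegralD// => H.
apply: (addIr (\int[kmul K1 K2 x]_z `|f z|)); rewrite H; congr (_ + _).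
by rewrite [RHS]/Rintegral En.
Qed.

End kernel_integrals.

(** * Coordinate oscillations and kernels with a controlled Laplace transform *)

Section oscillation.
Context {R : realType} {dT : measure_display} {T : measurableType dT} {N : nat}.
Variables (rho : T -> T -> R) (hrho : is_metric rho).
Hypothesis mrho : measurable_fun setT (fun z : T * T => rho z.1 z.2).
Local Notation X := (N.-tuple T).

Definition osc_le (f : X -> R) (a : 'I_N -> R) : Prop :=
  forall i x y, agree_off i x y ->
    `|f x - f y| <= a i * rho (tnth x i) (tnth y i).

Lemma osc_le_trans f a b : osc_le f a -> (forall i, a i <= b i) -> osc_le f b.
Proof.
case: hrho => d0 _ _ _ fa ab i x y xy; apply: le_trans (fa _ _ _ xy) _.
by rewrite ler_wpM2r.
Qed.

Lemma osc_le_norm f a : osc_le f a -> osc_le (fun x => `|f x|) a.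
Proof.
move=> fa i x y xy; apply: le_trans (fa i x y xy).
exact: ler_dist_dist.
Qed.

Lemma osc_leD f g a b : osc_le f a -> osc_le g b ->
  osc_le (fun x => f x + g x) (fun i => a i + b i).
Proof.
move=> fa gb i x y xy; rewrite mulrDl opprD addrACA.
by rewrite (le_trans (ler_normD _ _))// lerD// ?fa// gb.
Qed.

(** Telescoping along the points [h m], whose first [m] coordinates come from [y] and the others
    from [x]: consecutive points differ in one coordinate only. *)
Lemma osc_le_dL1 f a : osc_le f a -> forall x y,
  `|f x - f y| <= \sum_(i < N) a i * rho (tnth x i) (tnth y i).
Proof.
move=> fa x y.
pose h (m : nat) : X := [tuple if (i < m)%N then tnth y i else tnth x i | i < N].
have h0 : h 0%N = x by apply: eq_from_tnth => i; rewrite tnth_mktuple.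
have hN : h N = y by apply: eq_from_tnth => i; rewrite tnth_mktuple ltn_ord.
suff H m : (m <= N)%N -> `|f x - f (h m)| <=
    \sum_(i < N | (i < m)%N) a i * rho (tnth x i) (tnth y i).
  have := H N (leqnn N); rewrite hN => /le_trans; apply.
  by under eq_bigl do rewrite ltn_ord.
elim: m => [_|m IH mN]; first by rewrite h0 subrr normr0 big_pred0.
rewrite (bigD1 (Ordinal mN))//= addrC.
apply: le_trans (ler_distD (f (h m)) _ _) _; apply: lerD.
  apply: le_trans (IH (ltnW mN)) _; rewrite le_eqVlt; apply/orP; left.
  apply/eqP/eq_bigl => i; rewrite ltnS -(inj_eq val_inj)/= ltn_neqAle.
  by rewrite andbC.
have := fa (Ordinal mN) (h m) (h m.+1); rewrite !tnth_mktuple/= ltnn ltnSn; apply.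
move=> j; rewrite !tnth_mktuple -(inj_eq val_inj)/= => jm.
by rewrite [(j < m.+1)%N]ltnS [(j <= m)%N]leq_eqVlt (negbTE jm).
Qed.

Lemma agree_off_set_coord i (x : X) u v : agree_off i (set_coord i x u) (set_coord i x v).
Proof. by move=> j ji; rewrite !tnth_mktuple (negbTE ji). Qed.

Lemma osc_le_set_coord f a i x : osc_le f a -> forall u v,
  `|f (set_coord i x u) - f (set_coord i x v)| <= a i * rho u v.
Proof.
move=> fa u v; have := fa i _ _ (agree_off_set_coord x u v).
by rewrite !tnth_mktuple eqxx.
Qed.

(* [a] and [b] bound the oscillations before and after integration against [K];
   [v] bounds the defect in Jensen's inequality for the exponential. *)
Definition laplace_kernel (K : R.-pker X ~> X) (a b : 'I_N -> R) (v : R) : Prop :=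
  forall f, measurable_fun setT f -> osc_le f a ->
  [/\ forall x, (K x).-integrable setT (EFin \o f),
      osc_le (fun x => \int[K x]_y f y) b &
      forall x, (\int[K x]_y (expR (f y))%:E <=
                 (expR (\int[K x]_y f y + v))%:E)%E].

Lemma laplace_kernel_weaken K a a' b b' v v' : laplace_kernel K a b v ->
  (forall i, a' i <= a i) -> (forall i, b i <= b' i) -> v <= v' ->
  laplace_kernel K a' b' v'.
Proof.
move=> H aa bb vv f mf fa; have [I O L] := H f mf (osc_le_trans fa aa).
split => //; first exact: osc_le_trans bb.
by move=> x; rewrite (le_trans (L x))// lee_fin ler_expR lerD2l.
Qed.

Lemma laplace_kernel_id a : laplace_kernel kid a a 0.
Proof.
move=> f mf fa.
have I x : (kid x : {measure set X -> \bar R}).-integrable setT (EFin \o f).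
  apply/integrableP; split; first exact/measurable_EFinP.
  rewrite [X in (X < _)%E](_ : _ = \int[\d_x]_y `|(EFin \o f) y|)%E//.
  rewrite integral_dirac//; last first.
    by apply: measurableT_comp => //; exact/measurable_EFinP.
  by rewrite diracT mul1e ltry.
have E x : \int[kid x]_y f y = f x.
  rewrite [LHS](_ : _ = \int[\d_x]_y f y)//.
  rewrite /Rintegral integral_dirac//; last exact/measurable_EFinP.
  by rewrite diracT mul1e.
split => //.
- by move=> i x y xy; rewrite !E; exact: fa.
- move=> x; rewrite E addr0.
  rewrite [leLHS](_ : _ = \int[\d_x]_y (expR (f y))%:E)%E//.
  rewrite integral_dirac//; last by apply/measurable_EFinP; exact: measurableT_comp.
  by rewrite diracT mul1e.
Qed.

(** A function meets the right factor first: [K2] takes the bounds [a] to [b], then [K1] takes [b]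
    to [c]. The factor [expR v2] comes out of the integral against [K1], so the defects add. *)
Lemma laplace_kernel_kmul K1 K2 a b c v1 v2 :
  laplace_kernel K2 a b v2 -> laplace_kernel K1 b c v1 ->
  laplace_kernel (kmulp K1 K2) a c (v1 + v2) /\
  forall f, measurable_fun setT f -> osc_le f a -> forall x,
    \int[kmulp K1 K2 x]_y f y = \int[K1 x]_y \int[K2 y]_z f z.
Proof.
move=> H2 H1.
have key f : measurable_fun setT f -> osc_le f a -> forall x,
    (kmul K1 K2 x).-integrable setT (EFin \o f) /\
    \int[kmul K1 K2 x]_y f y = \int[K1 x]_y \int[K2 y]_z f z.
  move=> mf fa x; have [I2 O2 L2] := H2 f mf fa.
  have mn : measurable_fun setT (fun z => `|f z|) by exact: measurableT_comp.
  (* Fubini requires the [K2]-integral of [|f|] to be [K1]-integrable; this follows because [|f|]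
     obeys the same oscillation bounds as [f]. *)
  have [_ O2n _] := H2 _ mn (osc_le_norm fa).
  have [I1 _ _] := H1 _ (measurable_Rintegral_kernel K2 mn) O2n.
  exact: Rintegral_kmul.
split; last by move=> f mf fa x; exact: (key f mf fa x).2.
move=> f mf fa.
have [I2 O2 L2] := H2 f mf fa.
have mKf := measurable_Rintegral_kernel K2 mf.
have [I1 O1 L1] := H1 _ mKf O2.
split.
- by move=> x; exact: (key f mf fa x).1.
- move=> i x y xy; rewrite [X in `|X - _|](key f mf fa x).2.
  by rewrite [X in `|_ - X|](key f mf fa y).2; exact: O1.
- move=> x; rewrite [X in expR (X + _)](key f mf fa x).2.
  rewrite [leLHS]ge0_integral_kmul//; last first.
    by apply/measurable_EFinP; exact: measurableT_comp.
  apply: (@le_trans _ _ (\int[K1 x]_y ((expR v2)%:E * (expR (\int[K2 y]_z f z))%:E))%E).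
    apply: ge0_le_integral => //.
    + by move=> y _; apply: integral_ge0 => z _; rewrite lee_fin expR_ge0.
    + apply: measurable_fun_integral_kernel => //.
      * by move=> A mA; exact: measurable_kernel.
      * by apply/measurable_EFinP; exact: measurableT_comp.
    + by apply: measurable_funeM; apply/measurable_EFinP; exact: measurableT_comp.
    + by move=> y _; rewrite -EFinM -expRD addrC.
  rewrite ge0_integralZl//; last first.
    by apply/measurable_EFinP; exact: measurableT_comp.
  rewrite addrA expRD mulrC EFinM lee_wpmul2l//.
Qed.

End oscillation.

(** * One coordinate update, and sweeps over a list of sites *)

Section one_site_update.
Context {R : realType} {dT : measure_display} {T : measurableType dT} {N : nat}.
Variables (rho : T -> T -> R) (hrho : is_metric rho).
Hypothesis mrho : measurable_fun setT (fun z : T * T => rho z.1 z.2).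
Local Notation X := (N.-tuple T).
Variables (k : 'I_N -> R.-pker X ~> T) (c : 'I_N -> 'I_N -> R) (C1 : R).
Hypotheses (hoff : forall i, depends_off i (k i))
  (hM1 : forall i x, finite_moment rho (k i x)) (hC1 : 0 < C1)
  (hT1 : forall i x, T1_ineq rho C1 (kernel_at (k i) x))
  (c0 : forall i j, 0 <= c i j)
  (hc : forall i j x y, agree_off j x y -> tnth x j <> tnth y j ->
    (W1 rho (k i x) (k i y) <= (c i j * rho (tnth x j) (tnth y j))%:E)%E).

Lemma Rintegral_resample i x (f : X -> R) : measurable_fun setT f ->
  (k i x).-integrable setT (EFin \o (fun u => f (set_coord i x u))) ->
  (resample i (k i) x).-integrable setT (EFin \o f) /\
  \int[resample i (k i) x]_y f y = \int[k i x]_u f (set_coord i x u).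
Proof.
move=> mf If; have ms := @measurable_set_coordr _ T N i x.
have mE : measurable_fun setT (EFin \o f) by exact/measurable_EFinP.
split.
  exact: (integrable_pushforward ms mE If measurableT).
by rewrite /Rintegral; congr fine; exact: (integral_pushforward ms mE If measurableT).
Qed.

Lemma ge0_integral_resample i x (f : X -> \bar R) : measurable_fun setT f ->
  (forall y, (0 <= f y)%E) ->
  (\int[resample i (k i) x]_y f y = \int[k i x]_u f (set_coord i x u))%E.
Proof.
move=> mf f0; have ms := @measurable_set_coordr _ T N i x.
by rewrite [LHS](ge0_integral_pushforward ms (k i x) measurableT mf).
Qed.

Definition sweep1 (i : 'I_N) (a : 'I_N -> R) (j : 'I_N) : R :=
  if j == i then 0 else a j + c i j * a i.

(** Site [i] is forgotten, since neither [k i] nor the refilled point depends on it. Changing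
    another site [j] moves the integrand by at most [a j] and the law by at most [c i j] in
    transport distance, the latter acting on an [a i]-Lipschitz function. The Laplace bound is the
    one-site inequality for that function. *)
Lemma laplace_resample i a : (forall j, 0 <= a j) ->
  laplace_kernel rho (resample i (k i)) a (sweep1 i a) (C1 * a i ^+ 2 / 2).
Proof.
move=> a0 f mf fa.
pose F x u := f (set_coord i x u).
have mF x : measurable_fun setT (F x).
  exact: (measurableT_comp mf (measurable_set_coordr i x)).
have lF x u v : `|F x u - F x v| <= a i * rho u v by exact: (osc_le_set_coord i x fa).
have IF x y : (k i x).-integrable setT (EFin \o F y).
  exact: (lip_integrable hrho mrho (nu := kernel_at (k i) x) (hM1 i x) (mF y) (lF y)).
have E x := Rintegral_resample mf (IF x x).
split.
- by move=> x; exact: (E x).1.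
- move=> j x y xy; rewrite (E x).2 (E y).2 /sweep1.
  have [ji|ji] := eqVneq j i.
    rewrite mul0r normr_le0 subr_eq0; apply/eqP.
    move: xy; rewrite ji => xy.
    have -> : set_coord i x = set_coord i y.
      apply/funext => u; apply: eq_from_tnth => l; rewrite !tnth_mktuple.
      by case: eqVneq => // li; exact: xy.
    congr fine; apply: eq_measure_integral => A mA _.
    exact: (hoff (i := i)).
  have [xyj|xyj] := pselect (tnth x j = tnth y j).
    have -> : x = y.
      by apply: eq_from_tnth => l; case: (eqVneq l j) => [->|lj] //; exact: xy.
    rewrite subrr normr0; apply: mulr_ge0; last by case: hrho.
    by apply: addr_ge0 => //; exact: mulr_ge0.
  (* The metric is symmetric, so a bound on the signed difference, applied in both orders, gives the
     absolute value. *)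
  suff H x' y' : agree_off j x' y' -> tnth x' j <> tnth y' j ->
      \int[k i x']_u F x' u - \int[k i y']_u F y' u <=
      (a j + c i j * a i) * rho (tnth x' j) (tnth y' j).
    rewrite ler_norml lerNl opprB H// andbT.
    case: hrho => _ _ -> _; apply: H => [l lj|]; first exact/esym/xy.
    exact/nesym.
  move=> {}xy {}xyj.
  (* The mixed term with law at [x'] and integrand at [y'] separates the change of integrand from
     the change of law. *)
  rewrite -(subrK (\int[k i x']_u F y' u) (\int[k i x']_u F x' u)) -addrA mulrDl.
  apply: lerD.
  + rewrite -RintegralB//.
    have -> : a j * rho (tnth x' j) (tnth y' j) =
      \int[k i x']_u (cst (a j * rho (tnth x' j) (tnth y' j)) u).
      by rewrite Rintegral_cst// prob_kernel mulr1.
    apply: le_Rintegral => //.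
    * exact: (integrableB measurableT (IF x' x') (IF x' y')).
    * exact: (finite_measure_integrable_cst (kernel_at (k i) x')).
    * move=> u _; apply: le_trans (ler_norm _) _.
      have /(_ _)/le_trans := fa j (set_coord i x' u) (set_coord i y' u).
      rewrite !tnth_mktuple (negbTE ji); apply => //.
      move=> l lj; rewrite !tnth_mktuple; case: eqP => // _; exact: xy.
  + rewrite mulrAC mulrC.
    have yx : agree_off j y' x' by move=> l lj; exact/esym/xy.
    apply: (lip_W1 hrho mrho (a0 i) (mF y') (lF y') (IF y' y') (IF x' y')).
    by have := hc i yx (nesym xyj); case: hrho => _ _ -> _.
- move=> x; rewrite (E x).2 ge0_integral_resample//; last first.
    by apply/measurable_EFinP; exact: measurableT_comp.
  exact: (T1_laplace hrho mrho hC1 (hT1 i x) (mF x) (IF x x) (a0 i) (lF x)).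
Qed.

(** The induction runs in the order in which a function meets the kernels, the last site of [s]
    first. The number [A = m / (1 - r1)] solves [m + r1 * A = A]. It bounds the oscillation at each
    site about to be updated, hence the cost of that update and the amounts [c i j * A] it passes
    on; a site of [s] restarts from [0]. *)
Lemma sweep_laplace (a : 'I_N -> R) (m r1 : R) (s : seq 'I_N) :
  0 <= m -> r1 < 1 -> (forall j, \sum_i c i j <= r1) ->
  (forall j, 0 <= a j <= m) -> uniq s ->
  exists b v,
    [/\ laplace_kernel rho (\big[kmulp/kid]_(i <- s) resample i (k i)) a b v,
        forall j, 0 <= b j <= (if j \in s then 0 else m) +
                            \sum_(i <- s) c i j * (m / (1 - r1)) &
        v <= (size s)%:R * (C1 * (m / (1 - r1)) ^+ 2 / 2)].
Proof.
move=> m0 r1lt cr am; set A := m / (1 - r1).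
have r10 : 0 < 1 - r1 by rewrite subr_gt0.
have A0 : 0 <= A by rewrite divr_ge0// ltW.
have AE : m + r1 * A = A by rewrite /A; field; exact: lt0r_neq0.
move: A A0 AE => A A0 AE.
elim: s => [_|i s IH /= /andP[nis us]].
  exists a, 0; split; first by rewrite big_nil; exact: laplace_kernel_id.
  - by move=> j; rewrite big_nil addr0.
  - by rewrite mul0r.
have [b [v [Kb hb hv]]] := IH us.
have b0 j : 0 <= b j by case/andP: (hb j).
(* Site [i] is not in [s], so it holds its initial [m] plus what the sites of [s] sent to it, at
   most [r1 * A] by the column sum. *)
have bi : b i <= A.
  case/andP: (hb i) => _; rewrite (negbTE nis) => /le_trans; apply.
  rewrite -[leRHS]AE lerD2l -mulr_suml ler_wpM2r//.
  apply: le_trans (cr i).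
  rewrite [leRHS](bigID (mem s))/= -big_uniq//= lerDl.
  by apply: sumr_ge0.
exists (sweep1 i b), (v + C1 * b i ^+ 2 / 2); split.
- rewrite big_cons.
  rewrite addrC; have [K _] := laplace_kernel_kmul Kb (laplace_resample i b0).
  exact: K.
- move=> j; rewrite /sweep1 big_cons in_cons; case: eqVneq => [_|ji] /=.
    rewrite lexx add0r addr_ge0 ?mulr_ge0//.
    by apply: sumr_ge0 => l _; rewrite mulr_ge0.
  case/andP: (hb j) => _ bj.
  rewrite addr_ge0 ?mulr_ge0//= addrCA addrC lerD//.
  by rewrite ler_wpM2l.
- rewrite -[in leRHS]addn1 natrD mulrDl mul1r lerD//.
  rewrite ler_wpM2r// ler_wpM2l ?(ltW hC1)//.
  by rewrite ler_sqr ?nnegrE.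
Qed.

(* Weighting the sites still to be updated by [r] makes the total oscillation
   nonincreasing along a sweep: updating [i] trades [r * a i] for the mass
   [c i j * a i] spread over the other sites. *)
Lemma sweep_laplace_sum (a : 'I_N -> R) (r : R) (s : seq 'I_N) :
  r <= 1 -> (forall i, \sum_j c i j <= r) ->
  (forall j, 0 <= a j) -> uniq s ->
  exists b v,
    [/\ laplace_kernel rho (\big[kmulp/kid]_(i <- s) resample i (k i)) a b v,
        forall j, 0 <= b j &
        \sum_j (if j \in s then 1 else r) * b j <= r * \sum_j a j].
Proof.
move=> r1 cr a0.
elim: s => [_|i s IH /= /andP[nis us]].
  exists a, 0; split; first by rewrite big_nil; exact: laplace_kernel_id.
  - by [].
  - by rewrite mulr_sumr.
have [b [v [Kb b0 hb]]] := IH us.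
exists (sweep1 i b), (v + C1 * b i ^+ 2 / 2); split.
- rewrite big_cons addrC.
  have [K _] := laplace_kernel_kmul Kb
    (laplace_resample i b0).
  exact: K.
- by move=> j; rewrite /sweep1; case: ifP => // _; rewrite addr_ge0// mulr_ge0.
- apply: le_trans hb.
  rewrite (bigD1 i)//= [leRHS](bigD1 i)//= (negbTE nis) /sweep1 eqxx mulr0 add0r.
  apply: (@le_trans _ _ (\sum_(j < N | j != i)
      ((if j \in s then 1 else r) * b j + c i j * b i))).
    apply: ler_sum => j ji; rewrite (negbTE ji) in_cons (negbTE ji)/= mulrDr lerD2l.
    have r0 : 0 <= r by apply: le_trans (cr i); exact: sumr_ge0.
    by case: ifP => _; [rewrite mul1r|rewrite ler_piMl// mulr_ge0].
  rewrite big_split/= addrC lerD2r -mulr_suml ler_wpM2r//.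
  by apply: le_trans (cr i); rewrite [leRHS](bigD1 i)//= lerDr.
Qed.

End one_site_update.

(** * Laplace transforms and concentration along a Markov chain *)

Section markov_chain.
Context {R : realType} {dT : measure_display} {T : measurableType dT} {N : nat}.
Variables (rho : T -> T -> R).
Local Notation X := (N.-tuple T).
Variables (dOm : measure_display) (Om : measurableType dOm) (Px : probability Om R).
Variables (P : R.-pker X ~> X) (x : X) (Z : nat -> {RV Px >-> X}).
Hypothesis hZ : is_markov_chain P x Z.

Lemma markov_chain_step (n : nat) (f g : X -> R) :
  measurable_fun setT f -> measurable_fun setT g ->
  (forall y, (\int[P y]_z (expR (g z))%:E \is a fin_num)%E) ->
  (\int[Px]_w (expR (\sum_(1 <= k < n.+1) f (Z k w) + g (Z n.+1 w)))%:E =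
   \int[Px]_w ((expR (\sum_(1 <= k < n.+1) f (Z k w)))%:E *
     \int[P (Z n w)]_z (expR (g z))%:E))%E.
Proof.
move=> mf mg fing.
pose S w := \sum_(1 <= k < n.+1) f (Z k w).
have mS : measurable_fun setT S.
  by apply: measurable_sum => k; exact: measurableT_comp.
have meg : measurable_fun setT (fun z => (expR (g z))%:E).
  by apply/measurable_EFinP; exact: measurableT_comp.
under eq_integral do rewrite expRD EFinM.
have mZ k : measurable_fun setT (Z k) by exact: measurable_funP.
have mh1 : measurable_fun setT (fun w => (expR (g (Z n.+1 w)))%:E).
  exact: (measurableT_comp meg (mZ n.+1)).
have eg0 z : (0 <= (expR (g z))%:E)%E by rewrite lee_fin expR_ge0.
have mPg : measurable_fun setT (fun y => \int[P y]_z (expR (g z))%:E)%E.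
  apply: measurable_fun_integral_kernel => // A mA; exact: measurable_kernel.
have mh2 : measurable_fun setT (fun w => \int[P (Z n w)]_z (expR (g z))%:E)%E.
  exact: (measurableT_comp mPg (mZ n)).
have mexp : measurable_fun setT (EFin \o (@expR R)) by exact/measurable_EFinP.
have h20 w : (0 <= \int[P (Z n w)]_z (expR (g z))%:E)%E.
  by apply: integral_ge0.
apply: (ge0_integral_test mS mh1 mh2 (fun w => eg0 (Z n.+1 w)) h20 _
  (fun w => fing (Z n w)) _ mexp) => [//|B mB|y]; last by rewrite lee_fin expR_ge0.
have mSB : measurable (S @^-1` B).
  by rewrite -[X in measurable X]setTI; exact: mS.
apply: (@ge0_integral_mixture R _ _ _ Om X Om Px (S @^-1` B)
    (fun w => P (Z n w)) Px (S @^-1` B) (Z n.+1) mSB mSB (mZ n.+1) _ _ _ meg eg0).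
  by move=> A mA; exact: (measurableT_comp (measurable_kernel P A mA) (mZ n)).
move=> A mA; apply: hZ.2 => //.
pose Om' := g_sigma_algebraType (\big[setU/set0]_(i < n.+1)
    preimage_set_system setT (Z i : Om -> X) measurable).
have mZ' k : (k < n.+1)%N -> measurable_fun setT (Z k : Om' -> X).
  move=> kn _ A' mA'; rewrite setTI; apply: sub_sigma_algebra.
  rewrite (bigD1 (Ordinal kn))//=; left; exists A' => //.
  by rewrite setTI.
have mS' : measurable_fun setT (S : Om' -> R).
  (* Filtering the index list keeps the bound [k < n.+1] available in the induction on the list. *)
  rewrite (_ : S = fun w => \sum_(i <- [seq i <- index_iota 1 n.+1 |
      (1 <= i < n.+1)%N && true]) f (Z i w)); last first.
    by apply/funext => w; rewrite /S big_nat_cond -big_filter.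
  have : all (fun k => k < n.+1)%N [seq i <- index_iota 1 n.+1 | (1 <= i < n.+1)%N && true].
    by apply/allP => k; rewrite mem_filter => /andP[/andP[/andP[]]].
  elim: [seq _ <- _ | _] => [_|k s IH /= /andP[kn /IH IHs]].
    rewrite (_ : (fun w => _) = cst 0); first exact: measurable_cst.
    by apply/funext => w; rewrite big_nil.
  rewrite (_ : (fun w => _) = fun w => f (Z k w) + \sum_(i <- s) f (Z i w)).
    by apply: measurable_funD => //; exact: (measurableT_comp mf (mZ' k kn)).
  by apply/funext => w; rewrite big_cons.
by rewrite -[S @^-1` B]setTI; exact: mS'.
Qed.

Hypothesis hrho : is_metric rho.
Variables (q kap : R).
Hypotheses (q0 : 0 <= q) (q1 : q < 1)
  (hP : forall m, 0 <= m ->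
    laplace_kernel rho P (fun=> m) (fun=> q * m) (kap * m ^+ 2)).

(** Iterates contract oscillations geometrically. Later uses draw on integrability and on the factor
    [q ^+ n], so [v] is left existential. *)
Lemma kpow_laplace n m : 0 <= m ->
  exists v, laplace_kernel rho (kpow P n) (fun=> m) (fun=> q ^+ n * m) v.
Proof.
move=> m0; elim: n => [|n [v IH]].
  have K0 : laplace_kernel rho (kpow P 0) (fun=> m) (fun=> m) 0.
    exact: laplace_kernel_id.
  exists 0; apply: (laplace_kernel_weaken hrho K0) => //.
  by move=> i; rewrite mul1r.
have mn0 : 0 <= q ^+ n * m by rewrite mulr_ge0 ?exprn_ge0.
exists (kap * (q ^+ n * m) ^+ 2 + v).
have [K _] := laplace_kernel_kmul IH (hP mn0).
apply: (laplace_kernel_weaken hrho K) => // i.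
by rewrite exprS mulrA.
Qed.

Lemma Rintegral_kpowS n m f y : 0 <= m -> measurable_fun setT f ->
  osc_le rho f (fun=> m) ->
  \int[kpow P n.+1 y]_z f z = \int[P y]_z \int[kpow P n z]_z' f z'.
Proof.
move=> m0 mf fm; have [v IH] := kpow_laplace n m0.
have mn0 : 0 <= q ^+ n * m by rewrite mulr_ge0 ?exprn_ge0.
have [_ E] := laplace_kernel_kmul IH (hP mn0).
exact: E.
Qed.

(* [G n.+1 = f + P (G n)] is the conditional expectation of the remaining
   terms of the sum, and each transition of the chain costs at most the Laplace
   constant of [G]. *)
Lemma markov_chain_laplace (n : nat) (f : X -> R) (m : R) : 0 <= m ->
  measurable_fun setT f -> osc_le rho f (fun=> m) -> 0 <= kap ->
  (\int[Px]_w (expR (\sum_(1 <= k < n.+1) f (Z k w)))%:E <=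
   (expR (\sum_(1 <= k < n.+1) \int[kpow P k x]_y f y +
     n%:R * (kap * (m / (1 - q)) ^+ 2)))%:E)%E.
Proof.
move=> m0 mf fm kap0.
have q10 : 0 < 1 - q by rewrite subr_gt0.
set M := m / (1 - q).
have M0 : 0 <= M by rewrite divr_ge0// ltW.
pose u k y := \int[kpow P k y]_z f z.
have u0 y : u 0%N y = f y.
  rewrite /u [LHS](_ : _ = \int[\d_y]_z f z)//.
  rewrite /Rintegral integral_dirac//; last exact/measurable_EFinP.
  by rewrite diracT mul1e.
have mu k : measurable_fun setT (u k) by exact: measurable_Rintegral_kernel.
have uosc k : osc_le rho (u k) (fun=> q ^+ k * m).
  by have [v /(_ f mf fm)[]] := kpow_laplace k m0.
have uS k y : u k.+1 y = \int[P y]_z u k z by exact: (Rintegral_kpowS _ _ m0 mf fm).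
pose G k y := \sum_(i < k) u i y.
have mG k : measurable_fun setT (G k) by exact: measurable_sum.
have Gosc k : osc_le rho (G k) (fun=> M).
  (* The bounds for the iterates form a geometric series, and its sum stays below [m / (1 - q)]
     uniformly in [k]. *)
  have H : osc_le rho (G k) (fun=> \sum_(i < k) q ^+ i * m).
    elim: k => [|k IH].
      move=> i y z yz; rewrite /G !big_ord0 subrr normr0 mul0r//.
    move=> i y z yz; rewrite /G !big_ord_recr/=.
    exact: (osc_leD IH (uosc k)).
  apply: (osc_le_trans hrho H) => _; rewrite -mulr_suml mulrC ler_wpM2l//.
  rewrite -[leRHS]mul1r ler_pdivlMr//.
  have := subrX1 q k; have := exprn_ge0 k q0.
  by set s := \sum_(i < k) _ => qk; lra.
pose PG k y := \sum_(i < k) u i.+1 y.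
have PGE k y : \int[P y]_z G k z = PG k y.
  have Iu i : (P y).-integrable setT (EFin \o u i).
    have qm : 0 <= q ^+ i * m by rewrite mulr_ge0 ?exprn_ge0.
    by have [/(_ y)] := hP qm (mu i) (uosc i).
  have IG i : (P y).-integrable setT (EFin \o G i).
    by have [/(_ y)] := hP M0 (mG i) (Gosc i).
  elim: k => [|k IH].
    rewrite /PG /G big_ord0; under eq_Rintegral do rewrite big_ord0.
    by rewrite /Rintegral integral0.
  rewrite /PG big_ord_recr/= -/(PG k y) -IH uS -RintegralD//.
  by apply: eq_Rintegral => z _; rewrite /G big_ord_recr.
have GS k y : G k.+1 y = f y + PG k y.
  by rewrite /G big_ord_recl u0.
have mPG k : measurable_fun setT (PG k) by exact: measurable_sum.
have mPexpG k : measurable_fun setT (fun y => \int[P y]_z (expR (G k z))%:E)%E.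
  apply: measurable_fun_integral_kernel.
  - by move=> A mA; exact: measurable_kernel.
  - by move=> z; rewrite lee_fin expR_ge0.
  - by apply/measurable_EFinP; exact: measurableT_comp.
have PexpG k y : (\int[P y]_z (expR (G k z))%:E <= (expR (PG k y + kap * M ^+ 2))%:E)%E.
  by rewrite -PGE; have [_ _] := hP M0 (mG k) (Gosc k).
have fin k y : (\int[P y]_z (expR (G k z))%:E \is a fin_num)%E.
  rewrite ge0_fin_numE; first by apply: le_lt_trans (PexpG k y) _; rewrite ltry.
  by apply: integral_ge0 => z _; rewrite lee_fin expR_ge0.
have mZ k : measurable_fun setT (Z k) by exact: measurable_funP.
have mS j : measurable_fun setT (fun w => \sum_(1 <= k < j.+1) f (Z k w)).
  by apply: measurable_sum => k; exact: measurableT_comp.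
(* The exponent is the conditional mean of the whole sum given the states up to time [j]. At [j = 0]
   it is the constant [PG n x], at [j = n] the sum itself, and each transition costs
   [kap * M ^+ 2]. *)
have main j : (j <= n)%N ->
    (\int[Px]_w (expR (\sum_(1 <= k < j.+1) f (Z k w) + PG (n - j)%N (Z j w)))%:E <=
     (expR (PG n x + j%:R * (kap * M ^+ 2)))%:E)%E.
  elim: j => [_|j IH jn].
    rewrite subn0 mul0r addr0 le_eqVlt; apply/orP; left; apply/eqP.
    transitivity (\int[Px]_w (cst (expR (PG n x))%:E w))%E.
      apply: ae_eq_integral => //.
      - apply/measurable_EFinP; apply: measurableT_comp => //.
        by apply: measurable_funD; [exact: mS|exact: (measurableT_comp (mPG n) (mZ 0%N))].
      - case: hZ => h _; apply: filterS h => w hw _.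
        by rewrite big_geq// add0r hw.
    by rewrite integral_cst// [X in (_ * X)%E]probability_setT mule1.
  apply: le_trans; last first.
    rewrite -natr1 mulrDl mul1r addrA expRD mulrC EFinM.
    by apply: lee_wpmul2l; [rewrite lee_fin expR_ge0|exact: (IH (ltnW jn))].
  (* The newest term [f (Z j.+1)] joins the predicted remainder: with [PG (n - j.+1)] it makes
     [G (n - j)], to which the one-step identity applies. *)
  have -> : (\int[Px]_w (expR (\sum_(1 <= k < j.+2) f (Z k w) + PG (n - j.+1)%N (Z j.+1 w)))%:E =
    \int[Px]_w (expR (\sum_(1 <= k < j.+1) f (Z k w) + G (n - j)%N (Z j.+1 w)))%:E)%E.
    apply: eq_integral => w _; rewrite big_nat_recr//= -addrA -GS subnSK//.
  rewrite (markov_chain_step j mf (mG (n - j)%N) (fin _)).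
  rewrite -ge0_integralZl//; last first.
    apply/measurable_EFinP; apply: measurableT_comp => //.
    by apply: measurable_funD; [exact: mS|exact: (measurableT_comp (mPG _) (mZ j))].
  apply: ge0_le_integral => //.
  - move=> w _; rewrite mule_ge0 ?lee_fin ?expR_ge0//.
    by apply: integral_ge0 => z _; rewrite lee_fin expR_ge0.
  - apply: emeasurable_funM.
      by apply/measurable_EFinP; apply: measurableT_comp => //; exact: mS.
    exact: (measurableT_comp (mPexpG _) (mZ j)).
  - apply: measurable_funeM; apply/measurable_EFinP; apply: measurableT_comp => //.
    by apply: measurable_funD; [exact: mS|exact: (measurableT_comp (mPG _) (mZ j))].
  - move=> w _; rewrite expRD EFinM muleCA.
    apply: lee_wpmul2l; first by rewrite lee_fin expR_ge0.
    by apply: le_trans (PexpG _ _) _; rewrite expRD EFinM muleC.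
have := main n (leqnn n); rewrite subnn.
under eq_integral do rewrite /PG big_ord0 addr0.
move=> /le_trans; apply; rewrite lee_fin ler_expR lerD2r.
by rewrite /PG big_add1/= big_mkord.
Qed.

Lemma markov_chain_concentration (n : nat) (f : X -> R) (m t : R) :
  (0 < n)%N -> 0 < m -> 0 < t -> 0 < kap ->
  measurable_fun setT f -> osc_le rho f (fun=> m) ->
  (Px [set w | (n%:R^-1 * \sum_(1 <= k < n.+1) f (Z k w) -
      n%:R^-1 * \sum_(1 <= k < n.+1) \int[kpow P k x]_y f y >= t)%R]
   <= (expR (- (t ^+ 2 * (1 - q) ^+ 2 * n%:R / (4 * kap * m ^+ 2))))%:E)%E.
Proof.
move=> n0 m0 t0 kap0 mf fm.
have q10 : 0 < 1 - q by rewrite subr_gt0.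
have nR0 : 0 < n%:R :> R by rewrite ltr0n.
pose B := kap * m ^+ 2 / (1 - q) ^+ 2.
have B0 : 0 < B by rewrite divr_gt0 ?exprn_gt0// mulr_gt0 ?exprn_gt0.
(* Chernoff's exponent is [n * (B * la ^+ 2 - la * t)]; this choice of [la] minimises it, with value
   [- n * t ^+ 2 / (4 * B)]. *)
pose la := t / (2 * B).
have la0 : 0 < la by rewrite divr_gt0// mulr_gt0.
set A := [set w | _].
pose S w := \sum_(1 <= k < n.+1) f (Z k w).
pose M := \sum_(1 <= k < n.+1) \int[kpow P k x]_y f y.
have mS : measurable_fun setT S.
  by apply: measurable_sum => k; exact: measurableT_comp.
have AE : A = S @^-1` `[M + n%:R * t, +oo[.
  apply/seteqP; split => w; rewrite /A /= in_itv/= andbT -mulrBr.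
    by rewrite ler_pdivlMl// lerBrDl.
  by rewrite ler_pdivlMl// lerBrDl.
have mA : measurable A.
  by rewrite AE -[X in measurable X]setTI; apply: mS => //; exact: measurable_itv.
have mg : measurable_fun setT (fun y => la * f y) by exact: measurable_funM.
have gm : osc_le rho (fun y => la * f y) (fun=> la * m).
  move=> i y z yz; rewrite -mulrBr normrM gtr0_norm// -mulrA ler_pM2l//.
  exact: (fm i).
have gE k y : \int[kpow P k y]_z (la * f z) = la * \int[kpow P k y]_z f z.
  have [v /(_ f mf fm)[/(_ y) If _ _]] := kpow_laplace k (ltW m0).
  exact: (RintegralZl la measurableT If).
have := markov_chain_laplace n (mulr_ge0 (ltW la0) (ltW m0)) mg gm (ltW kap0).
have -> : \sum_(1 <= k < n.+1) \int[kpow P k x]_y (la * f y) = la * M.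
  by rewrite mulr_sumr; apply: eq_bigr => k _; rewrite gE.
under eq_integral do rewrite -mulr_sumr -/(S _).
set b := (X in (_ <= X)%E) => Hb.
have Ha : ((expR (la * (M + n%:R * t)))%:E * Px A <= b)%E.
  rewrite -integral_cst//; apply: le_trans Hb.
  have mY : measurable_fun setT (fun w => (expR (la * S w))%:E).
    by apply/measurable_EFinP; apply: measurableT_comp => //; exact: measurable_funM.
  apply: (@le_trans _ _ (\int[Px]_(w in A) (expR (la * S w))%:E)%E).
    apply: ge0_le_integral.
    - exact: mA.
    - by move=> w _; rewrite lee_fin expR_ge0.
    - exact: measurable_cst.
    - exact: (measurable_funTS mY).
    - move=> w; rewrite AE /= in_itv/= andbT => Aw.
      by rewrite lee_fin ler_expR ler_pM2l.
  apply: ge0_subset_integral => //.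
have -> : Px A = ((expR (- (la * (M + n%:R * t))))%:E *
    ((expR (la * (M + n%:R * t)))%:E * Px A))%E.
  by rewrite muleA -EFinM -expRD addNr expR0 mul1e.
apply: le_trans (lee_wpmul2l _ Ha) _; first by rewrite lee_fin expR_ge0.
rewrite /b -EFinM -expRD lee_fin ler_expR le_eqVlt; apply/orP; left; apply/eqP.
rewrite /la /B; field.
by rewrite !lt0r_neq0.
Qed.

End markov_chain.

(** * Invariance of [mu] under the sampler *)

Section invariance.
Context {R : realType} {dT : measure_display} {T : measurableType dT} {N : nat}.
Local Notation X := (N.-tuple T).
Variable mu : probability X R.

Definition box (A : 'I_N -> set T) : set X := [set t | forall j, A j (tnth t j)].

Definition boxes : set (set X) := [set box A | A in [set A | forall j, measurable (A j)]].

Lemma measurable_box A : (forall j, measurable (A j)) -> measurable (box A).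
Proof.
move=> mA; rewrite (_ : box A = \bigcap_(j in [set: 'I_N]) ((@tnth _ _)^~ j @^-1` A j)).
  apply: fin_bigcap_measurable => // j _.
  by rewrite -[X in measurable X]setTI; exact: measurable_tnth.
by apply/seteqP; split => t Bt j; [move=> _|]; exact: Bt.
Qed.

Lemma measurable_boxesE : (measurable : set (set X)) = <<s boxes >>.
Proof.
rewrite eqEsubset; split.
  apply: smallest_sub; first exact: smallest_sigma_algebra.
  apply: (big_ind (fun G => G `<=` <<s boxes >>)) => [//|G H GG HH|i _].
    by rewrite subUset.
  move=> _ [A mA <-]; apply: sub_sigma_algebra.
  exists (fun j => if j == i then A else setT).
    by move=> j; case: ifP.
  rewrite setTI; apply/seteqP; split => [t /(_ i)|t At j]; first by rewrite eqxx.
  by case: eqP => // ->.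
apply: smallest_sub; first exact: sigma_algebra_measurable.
by move=> _ [A mA <-]; exact: measurable_box.
Qed.

(** Boxes are stable under intersection and generate the product sigma-algebra, so they determine a
    finite measure. *)
Lemma eq_measure_boxes (m1 m2 : {measure set X -> \bar R}) : (m1 setT < +oo)%E ->
  (forall A, (forall j, measurable (A j)) -> m1 (box A) = m2 (box A)) ->
  forall A, measurable A -> m1 A = m2 A.
Proof.
move=> m1T m12 A mA.
apply: (measure_unique boxes (fun=> setT) measurable_boxesE) => //.
- move=> _ _ [B mB <-] [C mC <-]; exists (fun j => B j `&` C j).
    by move=> j; exact: measurableI.
  apply/seteqP; split => [t H|t [H1 H2] j]; last by split; [exact: H1|exact: H2].
  by split => j; case: (H j).
- move=> _; exists (fun=> setT) => //.
  by apply/seteqP; split.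
- by apply/seteqP; split => // t _; exists 0%N.
- by move=> _ [B mB <-]; exact: m12.
Qed.

(** Viewing [mu] as a kernel turns the measure [mu K] into a composition [kmul], to which the Fubini
    lemma for kernels applies. *)
Definition const_kernel : R.-pker X ~> X :=
  kprobability (@measurable_cst _ _ X _ setT (mu : pprobability X R)).

Definition invariant_kernel (K : R.-pker X ~> X) : Prop :=
  forall A, measurable A -> (\int[mu]_x K x A = mu A)%E.

Lemma ge0_integral_invariant K (g : X -> \bar R) : invariant_kernel K ->
  measurable_fun setT g -> (forall x, (0 <= g x)%E) ->
  (\int[mu]_x g x = \int[mu]_x \int[K x]_y g y)%E.
Proof.
move=> iK mg g0.
apply: (@ge0_integral_mixture R _ _ _ X X X mu setT K mu setT id) => //.
- by move=> A mA; exact: measurable_kernel.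
- by move=> A mA; rewrite setTI iK.
Qed.

Lemma Rintegral_invariant K (f : X -> R) : invariant_kernel K ->
  measurable_fun setT f -> mu.-integrable setT (EFin \o f) ->
  (forall x, (K x).-integrable setT (EFin \o f)) ->
  \int[mu]_x f x = \int[mu]_x \int[K x]_y f y.
Proof.
move=> iK mf If IK.
have mn : measurable_fun setT (fun z => `|f z|) by exact: measurableT_comp.
have x0 : X by exact: point.
have I1 : (const_kernel x0).-integrable setT (EFin \o (fun y => \int[K y]_z `|f z|)).
  apply/integrableP; split.
    by apply/measurable_EFinP; exact: measurable_Rintegral_kernel.
  rewrite [X in (X < _)%E](_ : _ = \int[mu]_y \int[K y]_z `|(f z)%:E|)%E.
    rewrite -ge0_integral_invariant//; last exact/measurable_EFinP.
    by case/integrableP : If.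
  apply: eq_integral => y _ /=; rewrite ger0_norm ?Rintegral_ge0//.
  rewrite fineK//; apply: integrable_fin_num => //.
  exact: (integrable_abse (IK y)).
have [_ E] := Rintegral_kmul mf IK I1.
transitivity (\int[kmul const_kernel K x0]_z f z); last exact: E.
by congr fine; apply: eq_measure_integral => A mA _; exact/esym/iK.
Qed.

Lemma invariant_kid : invariant_kernel kid.
Proof.
move=> A mA; have := integral_indic mu measurableT mA; rewrite setIT => <-.
exact: eq_integral.
Qed.

Lemma invariant_kmul K1 K2 : invariant_kernel K1 -> invariant_kernel K2 ->
  invariant_kernel (kmulp K1 K2).
Proof.
move=> i1 i2 A mA; rewrite -(i2 A mA) [RHS](ge0_integral_invariant i1)//.
exact: measurable_kernel.
Qed.

Lemma invariant_kpow K n : invariant_kernel K -> invariant_kernel (kpow K n).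
Proof.
move=> iK; elim: n => [|n IH]; first exact: invariant_kid.
exact: invariant_kmul.
Qed.

Lemma sigma_off_box i A : (forall j, measurable (A j)) ->
  sigma_off i (box (fun j => if j == i then setT else A j)).
Proof.
move=> mA.
pose X' := g_sigma_algebraType (\bigcup_(j in [set j | j != i])
        preimage_set_system setT (fun x : X => tnth x j) measurable).
rewrite (_ : box _ = \bigcap_(j in [set: 'I_N]) ((@tnth N T)^~ j @^-1`
    (if j == i then setT else A j))); last first.
  by apply/seteqP; split => t Bt j; [move=> _|]; exact: Bt.
apply: (@fin_bigcap_measurable _ X') => // j _.
case: eqVneq => [_|ji]; first exact: (@measurableT _ X').
by apply: sub_sigma_algebra; exists j => //; exists (A j) => //; rewrite setTI.
Qed.

(** Resampling site [i] lands in a box exactly when the other coordinates already fit, which is the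
    event [B], and the new one falls in [A i]. Since [B] ignores coordinate [i], the defining
    identity of the conditional law gives the [mu]-measure of the box. *)
Lemma invariant_resample i (k : R.-pker X ~> T) : is_conditional_law mu i k ->
  invariant_kernel (resample i k).
Proof.
move=> [koff kE].
have x0 : X by exact: point.
suff H A : measurable A -> kmul const_kernel (resample i k) x0 A = mu A by [].
move: A; apply: eq_measure_boxes.
  by rewrite prob_kernel ltry.
move=> A mA.
pose B := box (fun j => if j == i then setT else A j).
have sB : sigma_off i B by exact: sigma_off_box.
have mB : measurable B by apply: measurable_box => j; case: ifP.
transitivity (\int[mu]_(x in B) k x (A i))%E.
  rewrite [RHS]integral_mkcond; apply: eq_integral => x _.
  rewrite patchE; have -> : resample i k x (box A) = k x (set_coord i x @^-1` box A) by [].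
  case: ifPn => xB.
    congr (k x _); apply/seteqP; split => [u /(_ i)|u Au j].
      by rewrite tnth_mktuple eqxx.
    rewrite tnth_mktuple; case: eqP => [->//|/eqP ji].
    by move: xB; rewrite inE => /(_ j); rewrite (negbTE ji).
  rewrite (_ : _ @^-1` _ = set0) ?measure0//.
  apply/seteqP; split => // u uA; move: xB; rewrite notin_setE; apply => j.
  by case: eqVneq => // ji; have := uA j; rewrite tnth_mktuple (negbTE ji).
rewrite -kE//; congr (mu _); apply/seteqP; split => [x [Bx Ax] j|x H].
  by have := Bx j; case: eqP => // ->.
by split => [j|]; [case: ifP => // _; exact: H|exact: H].
Qed.

Lemma invariant_gibbs (k : 'I_N -> R.-pker X ~> T) :
  (forall i, is_conditional_law mu i (k i)) -> invariant_kernel (gibbs_kernel k).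
Proof.
move=> hk; rewrite /gibbs_kernel.
elim: (index_enum _) => [|i s IH]; first by rewrite big_nil; exact: invariant_kid.
by rewrite big_cons; apply: invariant_kmul => //; exact: invariant_resample.
Qed.

End invariance.

(** * Joint measurability of a lower semicontinuous metric *)

Section borel_metric.
Context {R : realType}.

(** The sets where [d] exceeds a constant are open in [E * E]. Separability writes each as a
    countable union of products of balls, which are measurable for the product of the two Borel
    sigma-algebras. *)
Lemma measurable_lower_semicontinuous2 (E : ptopologicalType)
    (d : borel E -> borel E -> R) : polish R E ->
  lower_semicontinuous (fun z : E * E => (d z.1 z.2)%:E) ->
  measurable_fun setT (fun z : borel E * borel E => d z.1 z.2).
Proof.
move=> [[D cD dD] [rho [[r0 r1 rC rt] rm _]]] /lower_semicontinuousP hl.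
apply: (measurability _ (RGenOInfty.measurableE R)) => _ [_ [a ->] <-].
rewrite setTI; set U := (X in measurable X).
have oU : open (U : set (E * E)).
  have := hl a; congr open; apply/seteqP; split => z /=.
    by rewrite lte_fin /U/= in_itv/= andbT.
  by rewrite lte_fin /U/= in_itv/= andbT.
pose B (p : E) (n : nat) : set E := [set y | rho p y < n.+1%:R^-1].
have mB p n : measurable (B p n : set (borel E)).
  apply: sub_sigma_algebra; rewrite /= openE => y /= yB.
  apply/rm; exists (n.+1%:R^-1 - rho p y); first by rewrite subr_gt0.
  by move=> w /=; rewrite ltrBrDl; exact: le_lt_trans (rt _ _ _).
pose I := [set i : E * E * nat | [/\ D i.1.1, D i.1.2 &
  B i.1.1 i.2 `*` B i.1.2 i.2 `<=` U]].
have cI : countable I.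
  apply: (@sub_countable _ _ _ (D `*` D `*` [set: nat])).
    by apply: subset_card_le => -[[p q] n] [].
  by apply: countableX => //; exact: countableX.
have -> : U = \bigcup_(i in I) (B i.1.1 i.2 `*` B i.1.2 i.2).
  apply/seteqP; split => [z Uz|z [i [_ _ h]]]; last exact: h.
  have : nbhs z (U : set (E * E)) by move: oU; rewrite openE; exact.
  case=> -[/= A1 A2] [/rm[e1 e10 h1] /rm[e2 e20 h2]] h12.
  pose e := Num.min e1 e2.
  have e0 : 0 < e by rewrite lt_min e10.
  (* Centres are picked in [D] within [n.+1%:R^-1] of [z]. The balls of that radius then contain [z]
     and, the radius being below [e / 2], stay within distance [e] of it. *)
  have [n ne] : exists n : nat, n.+1%:R^-1 < e / 2.
    have [n _ /(_ n (leqnn n)) hn] := near_infty_natSinv_lt (PosNum (divr_gt0 e0 (ltr0n R 2))).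
    by exists n; exact: hn.
  have pick (w : E) : exists2 p, D p & rho p w < n.+1%:R^-1.
    have [||p [pw Dp]] := dD (B w n).
    - by exists w; rewrite /B/= ((r1 w w).2 erefl) invr_gt0.
    - rewrite openE => y /= yB.
      apply/rm; exists (n.+1%:R^-1 - rho w y); first by rewrite subr_gt0.
      by move=> v /=; rewrite ltrBrDl; exact: le_lt_trans (rt _ _ _).
    - by exists p => //; rewrite rC.
  have [p Dp pz] := pick z.1; have [q Dq qz] := pick z.2.
  exists (p, q, n) => //; split => //= -[y1 y2] [/= By1 By2].
  have close (w v y : E) : rho w v < n.+1%:R^-1 -> B w n y -> rho v y < e.
    move=> wv wy; apply: le_lt_trans (rt _ w _) _.
    by rewrite (splitr e) ltrD//; [rewrite rC (lt_trans wv)|rewrite (lt_trans wy)].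
  apply: h12; split => /=.
    by apply: h1 => /=; have := close _ _ _ pz By1; rewrite lt_min => /andP[].
  by apply: h2 => /=; have := close _ _ _ qz By2; rewrite lt_min => /andP[].
rewrite bigcup_set_type; apply: countable_bigcupT_measurable => [|i].
  by rewrite (eq_countable (card_setT I)).
exact: measurableX.
Qed.

End borel_metric.

(** * From suprema of quotients to pointwise bounds *)

Section lipschitz_constants.
Context {R : realType} {dT : measure_display} {T : measurableType dT} {N : nat}.
Variables (rho : T -> T -> R) (hrho : is_metric rho).
Local Notation X := (N.-tuple T).
Implicit Types f : X -> R.

Lemma esup0_ub (A : set (\bar R)) a : A a -> (a <= esup0 A)%E.
Proof. by move=> Aa; apply: ereal_sup_ubound; left. Qed.

Lemma esup0_ge0 (A : set (\bar R)) : (0 <= esup0 A)%E.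
Proof. by apply: ereal_sup_ubound; right. Qed.

Lemma agree_off_eq i (x y : X) : agree_off i x y -> tnth x i = tnth y i -> x = y.
Proof.
by move=> xy xyi; apply: eq_from_tnth => l; case: (eqVneq l i) => [->|li] //; exact: xy.
Qed.

Lemma metric_refl u : rho u u = 0.
Proof. by case: hrho => _ d1 _ _; apply/d1. Qed.

Lemma metric_gt0 u v : u <> v -> 0 < rho u v.
Proof.
case: hrho => d0 d1 _ _ uv; rewrite lt_neqAle d0 andbT eq_sym.
by apply/eqP => /d1.
Qed.

Lemma dL1_agree_off i (x y : X) : agree_off i x y ->
  dL1 rho x y = rho (tnth x i) (tnth y i).
Proof.
case: hrho => _ d1 _ _ xy; rewrite /dL1 (bigD1 i)//= big1 ?addr0// => j ji.
by apply/d1; exact: xy.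
Qed.

Lemma osc_le_lip_norm f (al : R) : (lip_norm (dL1 rho) f <= al%:E)%E ->
  osc_le rho f (fun=> al).
Proof.
move=> hf i x y xy; have [xyi|xyi] := pselect (tnth x i = tnth y i).
  by rewrite (agree_off_eq xy xyi) subrr normr0 metric_refl mulr0.
rewrite -ler_pdivrMr ?metric_gt0// -lee_fin; apply: le_trans hf.
apply: esup0_ub; exists x, y; split; first by move=> E; apply: xyi; rewrite E.
by rewrite (dL1_agree_off xy).
Qed.

Lemma coord_osc_le f (a : 'I_N -> R) i : 0 <= a i -> osc_le rho f a ->
  (coord_osc rho f i <= (a i)%:E)%E.
Proof.
move=> a0 fa; apply: ge_ereal_sup => _ [[x [y [xy xyi ->]]]|->].
  by rewrite lee_fin ler_pdivrMr ?metric_gt0//; exact: fa.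
by rewrite lee_fin.
Qed.

Lemma osc_le_coord_osc f : (forall i, coord_osc rho f i \is a fin_num) ->
  osc_le rho f (fun i => fine (coord_osc rho f i)).
Proof.
move=> ff i x y xy; have [xyi|xyi] := pselect (tnth x i = tnth y i).
  by rewrite (agree_off_eq xy xyi) subrr normr0 metric_refl mulr0.
rewrite -ler_pdivrMr ?metric_gt0// -lee_fin fineK//.
by apply: esup0_ub; exists x, y.
Qed.

Lemma W1_le_dobrushin (k : 'I_N -> R.-pker X ~> T) i j x y :
  dobrushin_coef rho k i j \is a fin_num ->
  agree_off j x y -> tnth x j <> tnth y j ->
  (W1 rho (k i x) (k i y) <=
   (fine (dobrushin_coef rho k i j) * rho (tnth x j) (tnth y j))%:E)%E.
Proof.
move=> cf xy xyj; have r0 := metric_gt0 xyj.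
rewrite EFinM fineK// -lee_pdivrMr//.
rewrite [X in (_ * X <= _)%E](_ : _ = (rho (tnth x j) (tnth y j))%:E^-1)%E.
  by apply: esup0_ub; exists x, y.
by rewrite inver gt_eqF.
Qed.

End lipschitz_constants.

(** * Full Gibbs sweeps: Laplace bound, contraction and bias *)

Section gibbs_sampler.
Context {R : realType} {dT : measure_display} {T : measurableType dT} {N : nat}.
Variables (rho : T -> T -> R) (hrho : is_metric rho).
Hypothesis mrho : measurable_fun setT (fun z : T * T => rho z.1 z.2).
Local Notation X := (N.-tuple T).
Variables (k : 'I_N -> R.-pker X ~> T) (c : 'I_N -> 'I_N -> R) (C1 : R).
Hypotheses (hoff : forall i, depends_off i (k i))
  (hM1 : forall i x, finite_moment rho (k i x)) (hC1 : 0 < C1)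
  (hT1 : forall i x, T1_ineq rho C1 (kernel_at (k i) x))
  (c0 : forall i j, 0 <= c i j)
  (hc : forall i j x y, agree_off j x y -> tnth x j <> tnth y j ->
    (W1 rho (k i x) (k i y) <= (c i j * rho (tnth x j) (tnth y j))%:E)%E).
Local Notation P := (gibbs_kernel k).

(** A full sweep visits each site once, so no initial term [m] survives; the [N] updates each cost
    at most [C1 / 2] times the square of [m / (1 - r1)]. *)
Lemma gibbs_laplace (r1 m : R) : 0 <= m -> r1 < 1 ->
  (forall j, \sum_i c i j <= r1) ->
  laplace_kernel rho P (fun=> m) (fun=> r1 / (1 - r1) * m)
    (N%:R * (C1 / (2 * (1 - r1) ^+ 2)) * m ^+ 2).
Proof.
move=> m0 r1lt cr.
have r10 : 0 < 1 - r1 by rewrite subr_gt0.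
have mm (j : 'I_N) : 0 <= (fun=> m) j <= m by rewrite m0 lexx.
have [b [v [K hb hv]]] := sweep_laplace hrho mrho hoff hM1 hC1 hT1 c0 hc
  m0 r1lt cr mm (index_enum_uniq 'I_N).
apply: (laplace_kernel_weaken hrho K) => [//|j|].
  case/andP: (hb j) => _; rewrite mem_index_enum add0r -mulr_suml => /le_trans; apply.
  by rewrite [leRHS]mulrAC -mulrA ler_wpM2r ?divr_ge0 ?(ltW r10).
apply: le_trans hv _.
have -> : size (index_enum 'I_N) = N 
  by rewrite -sum1_size big_const_ord iter_addn mul1n addn0.
rewrite le_eqVlt; apply/orP; left; apply/eqP; field.
by rewrite lt0r_neq0.
Qed.

(** After a full sweep every site carries weight [1] in the weighted sum, so each sweep multiplies
    the total oscillation by at most [r]. *)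
Lemma kpow_gibbs_laplace_sum (r : R) n (a : 'I_N -> R) : 0 <= r -> r <= 1 ->
  (forall i, \sum_j c i j <= r) -> (forall j, 0 <= a j) ->
  exists b v, [/\ laplace_kernel rho (kpow P n) a b v, forall j, 0 <= b j &
    \sum_j b j <= r ^+ n * \sum_j a j].
Proof.
move=> r0 r1 cr a0; elim: n => [|n [b [v [K b0 hb]]]].
  exists a, 0; split => //; last by rewrite mul1r.
  exact: laplace_kernel_id.
have [b' [v' [K' b'0 hb']]] := sweep_laplace_sum hrho mrho hoff hM1 hC1 hT1 c0 hc
  r1 cr b0 (index_enum_uniq 'I_N).
exists b', (v' + v); split => //.
  by have [] := laplace_kernel_kmul K K'.
rewrite exprS -mulrA; apply: le_trans (ler_wpM2l r0 hb).
apply: le_trans hb'; rewrite le_eqVlt; apply/orP; left; apply/eqP.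
by apply: eq_bigr => j _; rewrite mem_index_enum mul1r.
Qed.

Variable mu : probability X R.

(** The telescoping bound of [osc_le_dL1], integrated over [y]. *)
Lemma osc_le_integrable (f : X -> R) (b : 'I_N -> R) (x : X) :
  measurable_fun setT f -> osc_le rho f b ->
  (forall i, mu.-integrable setT (fun y => (rho (tnth x i) (tnth y i))%:E)) ->
  mu.-integrable setT (EFin \o f) /\
  `|f x - \int[mu]_y f y| <=
    \sum_i b i * \int[mu]_y rho (tnth x i) (tnth y i).
Proof.
move=> mf fb Ir.
have Irb i : mu.-integrable setT (EFin \o (fun y => b i * rho (tnth x i) (tnth y i))).
  exact: (integrableZl measurableT (b i) (Ir i)).
have Is : mu.-integrable setT
    (EFin \o (fun y => \sum_i b i * rho (tnth x i) (tnth y i))).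
  rewrite (_ : EFin \o _ = fun y => (\sum_i (b i * rho (tnth x i) (tnth y i))%:E)%E).
    by apply: integrable_sum => // i _; exact: Irb.
  by apply/funext => y /=; rewrite sumEFin.
have Icst (z : R) : mu.-integrable setT (EFin \o cst z).
  exact: finite_measure_integrable_cst.
have If : mu.-integrable setT (EFin \o f).
  apply: (le_integrable measurableT _ _ (integrableD measurableT (Icst `|f x|) Is)).
    exact/measurable_EFinP.
  move=> y _; rewrite /= lee_fin; apply: le_trans (ler_norm _).
  rewrite -lerBlDl (le_trans (lerB_dist _ _))// distrC.
  exact: osc_le_dL1.
split => //.
have fx : f x = \int[mu]_y (cst (f x) y).
  by rewrite Rintegral_cst// [X in fine X]probability_setT mulr1.
have sE : \int[mu]_y (\sum_i b i * rho (tnth x i) (tnth y i)) =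
    \sum_i b i * \int[mu]_y rho (tnth x i) (tnth y i).
  rewrite /Rintegral; under eq_integral do rewrite -sumEFin.
  rewrite integral_sum//.
  have E i : (\int[mu]_y (b i * rho (tnth x i) (tnth y i))%:E =
      (b i * \int[mu]_y rho (tnth x i) (tnth y i))%:E)%E.
    rewrite -(RintegralZl (b i) measurableT (Ir i)) fineK//.
    by apply: integrable_fin_num => //; exact: Irb.
  by under eq_bigr do rewrite E; rewrite sumEFin.
rewrite {1}fx -RintegralB// -sE.
apply: le_trans (le_normr_Rintegral _ _) _ => //.
  exact: (integrableB measurableT (Icst (f x)) If).
apply: le_Rintegral => //.
- exact: (integrable_abse (integrableB measurableT (Icst (f x)) If)).
- by move=> y _; exact: (osc_le_dL1 fb x y).
Qed.

(** By invariance the [mu]-mean of [f] is that of its [n]-th iterate, so the bias is the distance of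
    this iterate from its own mean, controlled by its contracted total oscillation. *)
Lemma kpow_gibbs_bias (r : R) n (f : X -> R) (a : 'I_N -> R) (x : X) (I : R) :
  0 <= r -> r <= 1 -> (forall i, \sum_j c i j <= r) -> (forall j, 0 <= a j) ->
  (forall i, is_conditional_law mu i (k i)) ->
  measurable_fun setT f -> osc_le rho f a ->
  (forall i, mu.-integrable setT (fun y => (rho (tnth x i) (tnth y i))%:E)) ->
  (forall i, \int[mu]_y rho (tnth x i) (tnth y i) <= I) -> 0 <= I ->
  `|\int[kpow P n x]_y f y - \int[mu]_y f y| <= r ^+ n * (I * \sum_i a i).
Proof.
move=> r0 r1 cr a0 hcond mf fa Ir hI I0.
have [b [v [K b0 hb]]] := kpow_gibbs_laplace_sum n r0 r1 cr a0.
have [IK Kb _] := K f mf fa.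
have mK := measurable_Rintegral_kernel (kpow P n) mf.
have [If _] := osc_le_integrable mf fa Ir.
have [_ hx] := osc_le_integrable mK Kb Ir.
rewrite (Rintegral_invariant (invariant_kpow n (invariant_gibbs hcond)) mf If IK).
apply: le_trans hx _.
apply: (@le_trans _ _ (\sum_i b i * I)); first by apply: ler_sum => i _; rewrite ler_wpM2l.
by rewrite -mulr_suml mulrCA mulrC ler_wpM2l.
Qed.

End gibbs_sampler.

(** * Finite matrix norms as bounds on real row and column sums *)

Section matrix_norms.
Context {R : realType} {N : nat}.
Implicit Types F : 'I_N -> \bar R.

Lemma fin_num_bigmaxe F : (forall i, F i \is a fin_num) ->
  \big[maxe/0%E]_i F i \is a fin_num.
Proof.
by move=> Ff; elim/big_ind : _ => // a b fa fb; rewrite /maxe; case: ifP.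
Qed.

Lemma fine_le_bigmaxe F i : (forall i, F i \is a fin_num) ->
  fine (F i) <= fine (\big[maxe/0%E]_i F i).
Proof.
move=> Ff; rewrite fine_le ?fin_num_bigmaxe//.
exact: le_bigmax.
Qed.

Lemma sume_ub_fine F (r : \bar R) : (forall i, 0 <= F i)%E -> (\sum_i F i <= r)%E ->
  (r < +oo)%E -> (forall i, F i \is a fin_num) /\ \sum_i fine (F i) <= fine r.
Proof.
move=> F0 Fr roo.
have fr : r \is a fin_num.
  by rewrite ge0_fin_numE// (le_trans _ Fr)// sume_ge0.
have ff i : F i \is a fin_num.
  rewrite ge0_fin_numE//; apply: le_lt_trans roo; apply: le_trans Fr.
  by rewrite (bigD1 i)//= leeDl// sume_ge0.
split => //; rewrite -lee_fin -sumEFin fineK//.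
by under eq_bigr do rewrite fineK//.
Qed.

Lemma matrix_norm1_ub (c : 'I_N -> 'I_N -> \bar R) j : (forall i j, 0 <= c i j)%E ->
  (matrix_norm1 c < +oo)%E -> (forall i, c i j \is a fin_num) /\
  \sum_i fine (c i j) <= fine (matrix_norm1 c).
Proof.
move=> c0 coo; apply: sume_ub_fine => //.
exact: (le_bigmax _ (fun j => \sum_i c i j)%E).
Qed.

Lemma matrix_normoo_ub (c : 'I_N -> 'I_N -> \bar R) i : (forall i j, 0 <= c i j)%E ->
  (matrix_normoo c < +oo)%E -> \sum_j fine (c i j) <= fine (matrix_normoo c).
Proof.
move=> c0 coo; apply: (sume_ub_fine (F := c i) _ _ coo).2 => //.
exact: (le_bigmax _ (fun i => \sum_j c i j)%E).
Qed.

End matrix_norms.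

Lemma sum_expr_le {R : realFieldType} (r : R) n : 0 <= r -> r < 1 ->
  \sum_(1 <= k < n.+1) r ^+ k <= r / (1 - r).
Proof.
move=> r0 r1; have r10 : 0 < 1 - r by rewrite subr_gt0.
rewrite ler_pdivlMr// big_add1/= big_mkord.
under eq_bigr do rewrite exprS.
rewrite -mulr_sumr -mulrA ler_piMr//.
have := subrX1 r n; have := exprn_ge0 n r0.
by set s := \sum_(i < n) _ => qk; lra.
Qed.

(** * Concentration of the Gibbs sampler around its mean and around [mu] *)

Theorem theorem2p7
  (R : realType) (E : ptopologicalType) (hE : polish R E)
  (d : borel E -> borel E -> R) (hd : is_metric d)
  (hlsc : lower_semicontinuous (fun z : E * E => (d z.1 z.2)%:E))
  (N : nat) (hN : (0 < N)%N)
  (pi0 : {sigma_finite_measure set (borel E) -> \bar R})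
  (V : N.-tuple (borel E) -> R)
  (mu : probability (N.-tuple (borel E)) R)
  (hmu : is_gibbs pi0 V mu)
  (mui : 'I_N -> R.-pker (N.-tuple (borel E)) ~> (borel E))
  (hcond : forall i, is_conditional_law mu i (mui i))
  (hdens : forall i, gibbs_conditional_density pi0 V i (mui i))
  (hmoment : exists x0 : N.-tuple (borel E), forall i,
    (\int[mu]_y (d (tnth y i) (tnth x0 i))%:E < +oo)%E)
  (hM1 : forall i x, finite_moment d (mui i x))
  (hLip : forall i, lipschitz_W1 d (mui i))
  (r1 := matrix_norm1 (dobrushin_coef d mui))
  (hr1 : (r1 < (2^-1)%:E)%E)
  (C1 : R) (hC1 : 0 < C1)
  (hT1 : forall i x, T1_ineq d C1 (kernel_at (mui i) x))
  (P := gibbs_kernel mui)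
  (alpha : R) (halpha : 0 < alpha)
  (f : N.-tuple (borel E) -> R) (mf : measurable_fun setT f)
  (hf : (lip_norm (dL1 d) f <= alpha%:E)%E)
  (x : N.-tuple (borel E))
  (dOm : measure_display) (Om : measurableType dOm) (Px : probability Om R)
  (Z : nat -> {RV Px >-> N.-tuple (borel E)})
  (hZ : is_markov_chain P x Z) :
  (forall (t : R) (n : nat), 0 < t -> (0 < n)%N ->
    (Px [set w | (n%:R^-1 * \sum_(1 <= k < n.+1) f (Z k w)
                  - n%:R^-1 * \sum_(1 <= k < n.+1) \int[kpow P k x]_y f y
                  >= t)%R]
     <= (expR (- (t ^+ 2 * (1 - 2 * fine r1) ^+ 2 * n%:R
                  / (2 * C1 * alpha ^+ 2 * N%:R))))%:E)%E)
  /\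
  (let r := matrix_normoo (dobrushin_coef d mui) in
   (r < 1)%E ->
   forall (t : R) (n : nat), 0 < t -> (0 < n)%N ->
    (Px [set w | (n%:R^-1 * \sum_(1 <= k < n.+1) f (Z k w)
                  - \int[mu]_y f y
                  >= bias_const d mu r f x / n%:R + t)%R]
     <= (expR (- (t ^+ 2 * (1 - 2 * fine r1) ^+ 2 * n%:R
                  / (2 * C1 * alpha ^+ 2 * N%:R))))%:E)%E).

Proof.
have mrho := measurable_lower_semicontinuous2 hE hlsc.
have [d0 d1 dC dt] := hd.
have D0 i j : (0 <= dobrushin_coef d mui i j)%E by exact: esup0_ge0.
have r1oo : (r1 < +oo)%E by apply: lt_trans hr1 _; rewrite ltry.
have r1_ge0 : (0 <= r1)%E.
  by rewrite /r1 /matrix_norm1; elim/big_ind : _ => // [a b a0 b0|j _];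
    [rewrite le_max a0|exact: sume_ge0].
have r1f : r1 \is a fin_num by rewrite ge0_fin_numE.
set s1 := fine r1.
have s10 : 0 <= s1 by exact: fine_ge0.
have s1lt : s1 < 2^-1 by rewrite -lte_fin fineK.
have [cf cs] : (forall i j, dobrushin_coef d mui i j \is a fin_num) /\
    (forall j, \sum_i fine (dobrushin_coef d mui i j) <= s1).
  by split=> [i j|j]; have [] := matrix_norm1_ub j D0 r1oo.
pose c i j := fine (dobrushin_coef d mui i j).
have c0 i j : 0 <= c i j by exact: fine_ge0.
have hc i j u v : agree_off j u v -> tnth u j <> tnth v j ->
    (W1 d (mui i u) (mui i v) <= (c i j * d (tnth u j) (tnth v j))%:E)%E.
  exact: W1_le_dobrushin.
have hoff i : depends_off i (mui i) by case: (hcond i).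
have s1lt1 : s1 < 1 by lra.
(* The contraction factor of one sweep; [q < 1] amounts to [s1 < 1/2]. As
   [1 - q = (1 - 2 * s1) / (1 - s1)], the powers of [1 - s1] in [q] and [kap] cancel in the final
   exponent. *)
pose q := s1 / (1 - s1).
pose kap := N%:R * (C1 / (2 * (1 - s1) ^+ 2)).
have q0 : 0 <= q by rewrite divr_ge0// subr_ge0 ltW.
have q1 : q < 1 by rewrite ltr_pdivrMr; lra.
have kap0 : 0 < kap.
  rewrite mulr_gt0 ?ltr0n// divr_gt0// mulr_gt0// exprn_gt0//; lra.
have hP m : 0 <= m ->
    laplace_kernel d P (fun=> m) (fun=> q * m) (kap * m ^+ 2).
  by move=> m0; exact: (gibbs_laplace hd mrho hoff hM1 hC1 hT1 c0 hc m0 s1lt1 cs).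
have fal : osc_le d f (fun=> alpha) by exact: osc_le_lip_norm.
have partA (t : R) (n : nat) : 0 < t -> (0 < n)%N ->
    (Px [set w | (n%:R^-1 * \sum_(1 <= k < n.+1) f (Z k w)
                  - n%:R^-1 * \sum_(1 <= k < n.+1) \int[kpow P k x]_y f y
                  >= t)%R]
     <= (expR (- (t ^+ 2 * (1 - 2 * s1) ^+ 2 * n%:R
                  / (2 * C1 * alpha ^+ 2 * N%:R))))%:E)%E.
  move=> t0 n0.
  have H := markov_chain_concentration hZ hd q0 q1 hP n0 halpha t0 kap0 mf fal.
  apply: le_trans H _; rewrite lee_fin ler_expR le_eqVlt; apply/orP; left; apply/eqP.
  rewrite /q /kap; field.
  rewrite !lt0r_neq0 ?ltr0n//; lra.
split => // r rlt1 t n t0 n0.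
(* Once the averaged bias is at most [bias_const / n], the event of the second claim is contained in
   that of the first. *)
apply: le_trans (partA t n t0 n0).
have roo : (r < +oo)%E by apply: lt_trans rlt1 _; rewrite ltry.
have r_ge0 : (0 <= r)%E.
  by rewrite /r /matrix_normoo; elim/big_ind : _ => // [a b a0 b0|j _];
    [rewrite le_max a0|exact: sume_ge0].
have rf : r \is a fin_num by rewrite ge0_fin_numE.
have cr i : \sum_j c i j <= fine r by exact: matrix_normoo_ub.
have fr0 : 0 <= fine r by exact: fine_ge0.
have fr1 : fine r < 1 by rewrite -lte_fin fineK.
have of_ i : coord_osc d f i \is a fin_num.
  rewrite ge0_fin_numE; last exact: esup0_ge0.
  apply: le_lt_trans (ltry alpha).
  exact: (coord_osc_le hd (a := fun=> alpha) (ltW halpha) fal).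
pose a i := fine (coord_osc d f i).
have a0 i : 0 <= a i by apply: fine_ge0; exact: esup0_ge0.
have fa : osc_le d f a by exact: osc_le_coord_osc.
have md i (u : borel E) : measurable_fun setT (fun y : N.-tuple (borel E) => d u (tnth y i)).
  by apply: (measurableT_comp (measurable_metric1 mrho u)); exact: measurable_tnth.
have [x0 hx0] := hmoment.
(* The moment assumption concerns the base point [x0]; the triangle inequality moves it to the
   starting point [x]. *)
have Ir i : mu.-integrable setT (fun y => (d (tnth x i) (tnth y i))%:E).
  have I0 : mu.-integrable setT (fun y => (d (tnth x0 i) (tnth y i))%:E).
    apply/integrableP; split; first by apply/measurable_EFinP; exact: md.
    under eq_integral do rewrite gee0_abs ?lee_fin// dC.
    exact: hx0.
  apply: (le_integrable measurableT _ _ (integrableD measurableT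
    (finite_measure_integrable_cst mu (d (tnth x i) (tnth x0 i)) measurableT) I0)).
    by apply/measurable_EFinP; exact: md.
  by move=> y _; rewrite /= lee_fin !ger0_norm ?addr_ge0.
have If i : (\int[mu]_y (d (tnth x i) (tnth y i))%:E \is a fin_num)%E.
  exact: integrable_fin_num.
set I := fine (\big[maxe/0%E]_(i < N) \int[mu]_y (d (tnth x i) (tnth y i))%:E)%E.
have hI i : \int[mu]_y d (tnth x i) (tnth y i) <= I.
  exact: (fine_le_bigmaxe i If).
have I0 : 0 <= I.
  by apply: le_trans (hI (Ordinal hN)); exact: Rintegral_ge0.
have bias k := kpow_gibbs_bias hd mrho hoff hM1 hC1 hT1 c0 hc k fr0 (ltW fr1) cr a0
  hcond mf fa Ir hI I0.
have oscE : fine (\sum_(i < N) coord_osc d f i)%E = \sum_i a i.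
  have -> : (\sum_(i < N) coord_osc d f i = \sum_(i < N) (a i)%:E)%E.
    by apply: eq_bigr => i _; rewrite fineK.
  by rewrite sumEFin.
have A0 : 0 <= I * \sum_i a i by rewrite mulr_ge0// sumr_ge0.
have nR0 : 0 < n%:R :> R by rewrite ltr0n.
(* Averaging the bias over [k] from [1] to [n] produces the sum of the [fine r ^+ k], at most
   [fine r / (1 - fine r)]; starting at [k = 1] yields the numerator. *)
have meanbias : n%:R^-1 * \sum_(1 <= k < n.+1) \int[kpow P k x]_y f y
    - \int[mu]_y f y <= bias_const d mu r f x / n%:R.
  rewrite /bias_const oscE -/I [leRHS]mulrC -[X in _ <= _ * X]mulrA.
  have -> : \int[mu]_y f y = n%:R^-1 * \sum_(1 <= k < n.+1) \int[mu]_y f y.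
    rewrite sumr_const_nat subn1/= -[X in _ * X]mulr_natl mulKf//.
    exact: lt0r_neq0.
  rewrite -mulrBr -sumrB ler_pM2l ?invr_gt0//.
  apply: (@le_trans _ _ (\sum_(1 <= k < n.+1) fine r ^+ k * (I * \sum_i a i))).
    apply: ler_sum => k _; apply: le_trans (ler_norm _) _; exact: bias.
  rewrite -mulr_suml ler_wpM2r//; exact: sum_expr_le.
have mset (z z' : R) : measurable [set w | (n%:R^-1 * \sum_(1 <= k < n.+1) f (Z k w) - z >= z')%R].
  have mS : measurable_fun setT
      (fun w => n%:R^-1 * \sum_(1 <= k < n.+1) f (Z k w) - z).
    apply: measurable_funB => //; apply: measurable_funM => //.
    by apply: measurable_sum => k; exact: measurableT_comp.
  rewrite -[X in measurable X]setTI.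
  rewrite (_ : [set w | _] = (fun w =>
      n%:R^-1 * \sum_(1 <= k < n.+1) f (Z k w) - z) @^-1` `[z', +oo[).
    by apply: mS => //; exact: measurable_itv.
  by apply/seteqP; split => w /=; rewrite in_itv/= andbT.
apply: le_measure; rewrite ?inE; [exact: mset|exact: mset|].
move=> w /= hw; lra.
Qed.
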